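(* Let $k\ge 2$. For every non-constant harmonic function $h$ on $SG_k$, the energy measure $\nu_h$ is a minimal energy-dominant measure. In particular, for any two non-constant harmonic functions $h_1,h_2$ on $SG_k$, the energy measures $\nu_{h_1}$ and $\nu_{h_2}$ are mutually absolutely continuous.
   Context: Let $q_1,q_2,q_3$ be the vertices of an equilateral triangle in $\mathbb{R}^2$ and $V_0=\{q_1,q_2,q_3\}$. For an integer $k\ge 2$, let $F_i(x)=x/k+b_{i,k}$, $1\le i\le k(k+1)/2$, where the vectors $b_{i,k}$ run over the points $\frac{1}{k}(a_1q_1+a_2q_2+a_3q_3)$ with $a_1,a_2,a_3$ non-negative integers and $a_1+a_2+a_3=k-1$. The level-$k$ Sierpiński gasket $K=SG_k$ is the unique non-empty compact set with $K=\bigcup_i F_i(K)$. For a word $w=w_1\cdots w_n$ in the indices $\{1,\dots,k(k+1)/2\}$ put $F_w=F_{w_1}\circ\cdots\circ F_{w_n}$ and $|w|=n$. Let $V_m=\bigcup_{|w|=m}F_w(V_0)$, and let $G_m$ be the graph on $V_m$ in which distinct $x,y$ are adjacent, $x\sim_m y$, if and only if $x,y\in F_w(V_0)$ for some $w$ with $|w|=m$. For functions $u,v$ set $\mathcal{E}_m(u,v)=r^{-m}\sum_{x\sim_m y}(u(x)-u(y))(v(x)-v(y))$ (sum over edges of $G_m$), where $r=r_k\in(0,1)$ is the renormalization constant, i.e. the unique constant such that for every $u:V_0\to\mathbb{R}$ the minimum of $\mathcal{E}_1(\tilde u,\tilde u)$ over all extensions $\tilde u:V_1\to\mathbb{R}$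 of $u$ equals $\mathcal{E}_0(u,u)$. For $u\in C(K)$ the sequence $\mathcal{E}_m(u,u)$ is non-decreasing in $m$, and $u$ has finite energy if $\lim_{m\to\infty}\mathcal{E}_m(u,u)<\infty$. A harmonic function on $SG_k$ is a continuous function $h:K\to\mathbb{R}$ such that for every $m\ge 1$ and every $x\in V_m\setminus V_0$, $\sum_{y\sim_m x}(h(y)-h(x))=0$; it is uniquely determined by its values on $V_0$. For $f$ of finite energy, the energy measure $\nu_f$ is the finite Borel measure on $K$ determined by $$\nu_f(F_wK)=\lim_{m\to\infty}r^{-m}\sum_{\{x,y\in F_wK;\ x\sim_m y\}}(f(x)-f(y))^2$$ for all words $w$ (sum over edges $\{x,y\}$ of $G_m$ with both endpoints in $F_wK$). A $\sigma$-finite Borel measure $\nu$ on $K$ is energy-dominant if $\nu_f\ll\nu$ for every $f$ of finite energy. It is a minimal energy-dominant measure if it is energy-dominant and $\nu\ll\nu'$ for every energy-dominant $\sigma$-finite Borel measure $\nu'$ on $K$. *)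

(* Defs.v *)
From HB Require Import structures.
From mathcomp Require Import all_boot all_order all_algebra.
From mathcomp Require Import all_classical all_reals all_analysis.
Set Implicit Arguments.
Unset Strict Implicit.
Unset Printing Implicit Defensive.
Import Order.TTheory GRing.Theory Num.Theory.
Import numFieldNormedType.Exports.
Local Open Scope classical_set_scope.
Local Open Scope ring_scope.

Notation plane R := ('rV[R]_2).

(* The plane with its Borel sigma-algebra.  The library's norm on ['rV[R]_2] is
   the sup norm, which induces the Euclidean topology. *)
Notation borel_plane R := (g_sigma_algebraType (@open (plane R))).

Definition euclidean_dist (R : realType) (x y : plane R) : R :=
  Num.sqrt (\sum_i (x 0 i - y 0 i) ^+ 2).

Definition equilateral (R : realType) (q : 'I_3 -> plane R) : Prop :=
  exists2 l : R, 0 < l &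
    forall i j : 'I_3, i != j -> euclidean_dist (q i) (q j) = l.

(* The k(k+1)/2 indices are the triples of natural numbers with sum k-1; the
   bound [a i < k] is implied by the sum condition when k > 0. *)
Definition cell_index (k : nat) : Type :=
  {a : {ffun 'I_3 -> 'I_k} | (\sum_i a i == k.-1)%N}.

Section Gasket.
Context {R : realType}.
Variables (k : nat) (q : 'I_3 -> plane R).

Definition V0 : set (plane R) := range q.

Definition cell_shift (a : cell_index k) : plane R :=
  k%:R^-1 *: \sum_i (val a i)%:R *: q i.

Definition cell_map (a : cell_index k) (x : plane R) : plane R :=
  k%:R^-1 *: x + cell_shift a.

Definition word_map (w : seq (cell_index k)) : plane R -> plane R :=
  foldr (fun a f => cell_map a \o f) id w.

Definition is_gasket (K : set (plane R)) : Prop :=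
  [/\ K !=set0, compact K & K = \bigcup_a (cell_map a @` K)].

Definition V (m : nat) : set (plane R) :=
  \bigcup_(w in [set w : seq (cell_index k) | size w = m]) (word_map w @` V0).

Definition adj (m : nat) (x y : plane R) : Prop :=
  x <> y /\ exists w : seq (cell_index k),
    [/\ size w = m, (word_map w @` V0) x & (word_map w @` V0) y].

(* Sum over the edges of G_m with both endpoints in A.  Each edge {x, y} occurs
   twice in the index set, as (x, y) and (y, x), hence the factor 1/2. *)
Definition edge_sum (m : nat) (A : set (plane R)) (u v : plane R -> R) : R :=
  2^-1 * \sum_(e \in [set e : plane R * plane R |
                       [/\ adj m e.1 e.2, A e.1 & A e.2]])
           ((u e.1 - u e.2) * (v e.1 - v e.2)).

(* Functions on V_m or K are represented by functions on the plane, of which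
   only the values on V_m or K are used. *)
Definition energy (r : R) (m : nat) (u v : plane R -> R) : R :=
  r ^- m * edge_sum m setT u v.

Definition is_renormalization_constant (r : R) : Prop :=
  0 < r < 1 /\
  forall u : plane R -> R,
    (exists2 u1 : plane R -> R, {in V0, u1 =1 u} &
        energy r 1 u1 u1 = energy r 0 u u) /\
    (forall u1 : plane R -> R, {in V0, u1 =1 u} ->
        energy r 0 u u <= energy r 1 u1 u1).

Variables (K : set (plane R)) (r : R).

(* The energies are non-decreasing in m, so a finite limit means convergence
   in R. *)
Definition finite_energy (u : plane R -> R) : Prop :=
  {within K, continuous u} /\ cvgn (fun m => energy r m u u).

Definition gasket_harmonic (h : plane R -> R) : Prop :=
  {within K, continuous h} /\
  forall (m : nat) (x : plane R), (1 <= m)%N -> V m x -> ~ V0 x ->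
    \sum_(y \in [set y | adj m y x]) (h y - h x) = 0.

Definition nonconstant_on (f : plane R -> R) : Prop :=
  exists x y, [/\ K x, K y & f x <> f y].

(* Borel measures on K are represented by the Borel measures on the plane that
   vanish outside K. *)
Definition carried_by (nu : {measure set (borel_plane R) -> \bar R}) : Prop :=
  nu (~` K) = 0%E.

Definition is_energy_measure (f : plane R -> R)
    (nu : {measure set (borel_plane R) -> \bar R}) : Prop :=
  [/\ carried_by nu, (nu K < +oo)%E &
      forall w : seq (cell_index k),
        (fun m => (r ^- m * edge_sum m (word_map w @` K) f f)%:E) @ \oo
          --> nu (word_map w @` K)].

Definition energy_dominant
    (nu : {measure set (borel_plane R) -> \bar R}) : Prop :=
  [/\ carried_by nu, sigma_finite setT nu &
      forall (f : plane R -> R)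
          (nu_f : {measure set (borel_plane R) -> \bar R}),
        finite_energy f -> is_energy_measure f nu_f -> nu_f `<< nu].

Definition minimal_energy_dominant
    (nu : {measure set (borel_plane R) -> \bar R}) : Prop :=
  energy_dominant nu /\
  forall nu' : {measure set (borel_plane R) -> \bar R},
    energy_dominant nu' -> nu `<< nu'.

End Gasket.

(* Main.v *)
Require Import Defs.
From HB Require Import structures.
From mathcomp Require Import all_boot all_order all_algebra.
From mathcomp Require Import all_classical all_reals all_analysis.
From mathcomp Require Import zify ring lra.
Set Implicit Arguments.
Unset Strict Implicit.
Unset Printing Implicit Defensive.
Import Order.TTheory GRing.Theory Num.Theory.
Import numFieldNormedType.Exports.
Local Open Scope classical_set_scope.
Local Open Scope ring_scope.

(* Minimality is immediate, since h itself has finite energy; the point is that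
   nu_f << nu_h for every f of finite energy. By Pythagoras, f is approximated in
   energy by its harmonic interpolations of level n, and Borel sets are
   approximated by finite unions of cells, so it suffices to compare the energies
   of the restrictions of two harmonic functions to finite unions of subcells.

   Two facts are needed. (1) The restriction of a nonconstant harmonic function
   to a cell is nonconstant. On the triangular grid V_1, order the vertices by
   the values of the function, ties being broken by a linear form, and count the
   sign changes of the function around each vertex. Harmonicity gives at least 2
   of them at interior vertices and at least 1 on the sides, while the total is
   the number of triangles; this leaves no room for a saddle. A constant triangle
   would give a saddle for a suitable choice of the linear form, unless the
   function is constant around that triangle, and then it is constant everywhere.
   (2) Two nonconstant harmonic functions x, y cannot have mutually singular
   energy measures: they would be orthogonal on every cell, hence, the corner
   restriction having distinct eigenvalues on symmetric and antisymmetric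
   functions, at each corner one of the fluxes of x, y would vanish; but the
   three fluxes of a nonconstant function sum to zero, so at most one of them
   vanishes.

   A quantitative form of (2), combined with (1) through a stopping argument on
   the tree of cells, gives uniform absolute continuity. *)

(** * Masses on a tree of words *)

(** The energy measure of [f] is reached only through functions that are harmonic on each cell of
    level n, and these change with n and with the cell. Comparing two fixed harmonic functions is
    therefore not enough: one modulus of absolute continuity has to serve all pairs of boundary
    values. It is found on finite trees of words, without any limit measure. The quantitative form
    of (2) is a single [delta], valid for all boundary values and all depths: a set of subcells with
    at most the proportion [delta] of the energy of x has at most the proportion 1 - [delta] of the
    energy of y. Fact (1) enters twice. It bounds the energy of a child from below by a fixed
    fraction of that of its parent, so that the set can be enlarged to whole cells at a controlled
    cost, each enlargement gaining a factor 1 - [delta] for y; and it keeps the energy of h on every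
    cell of level n away from 0. At a corner, (2) rests on one identity in which the antisymmetric
    parts cancel and only the product of the two fluxes remains. *)

Section TreeMass.
Variables (R : realType) (T : finType) (X : Type).
Variables (A : T -> X -> X) (rho : R) (e : X -> R).
Hypothesis rho_gt0 : 0 < rho.
Hypothesis e_ge0 : forall x, 0 <= e x.
Hypothesis e_split : forall x, e x = \sum_a rho * e (A a x).

(** The energy of [x] carried by the words of length [N] in [S]. Only the values of [S] at that
    length count, so a set of shorter words is represented by their extensions. *)
Fixpoint mass (N : nat) (x : X) (S : pred (seq T)) : R :=
  if N is N'.+1 then \sum_a rho * mass N' (A a x) (fun w => S (a :: w))
  else if S [::] then e x else 0.

Lemma mass_ge0 N x S : 0 <= mass N x S.
Proof.
elim: N x S => [|N IH] x S /=; first by case: ifP.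
by apply: sumr_ge0 => a _; apply: mulr_ge0; [exact: ltW | exact: IH].
Qed.

Lemma massC N x S : mass N x S + mass N x (fun w => ~~ S w) = e x.
Proof.
elim: N x S => [|N IH] x S /=; first by case: (S [::]); rewrite /= ?addr0 ?add0r.
rewrite -big_split /= [RHS]e_split; apply: eq_bigr => a _.
by rewrite -mulrDr IH.
Qed.

Lemma mass_le N x S : mass N x S <= e x.
Proof. by rewrite -(massC N x S) lerDl mass_ge0. Qed.

Lemma mass_child N x S a :
  rho * mass N (A a x) (fun w => S (a :: w)) <= mass N.+1 x S.
Proof.
rewrite /= (bigD1 a) //= lerDl; apply: sumr_ge0 => b _.
by apply: mulr_ge0; [exact: ltW | exact: mass_ge0].
Qed.

Lemma mass_predT N x : mass N x predT = e x.
Proof.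
rewrite -(massC N x predT); suff -> : mass N x (fun w => ~~ predT w) = 0 by rewrite addr0.
by elim: N x => //= N IH x; rewrite big1 // => a _; rewrite IH mulr0.
Qed.

Variables (c delta gamma : R).
Hypothesis c_gt0 : 0 < c.
Hypothesis e_child : forall a x, c * e x <= rho * e (A a x).
Hypothesis delta01 : 0 < delta < 1.
Hypothesis gamma01 : 0 < gamma < 1.
Hypothesis mass_dichotomy : forall N x y S, 0 < e x ->
  mass N x S <= delta * e x -> mass N y S <= gamma * e y.

Let e_child_gt0 a x : 0 < e x -> 0 < e (A a x).
Proof.
move=> ex; rewrite -(pmulr_rgt0 _ rho_gt0).
by apply: lt_le_trans (e_child a x); apply: mulr_gt0.
Qed.

(* A stopping argument: P consists of the first cells having a child of which S
   fills more than the proportion delta. *)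
Lemma mass_stopping N x y S : 0 < e x -> mass N x S <= delta * e x ->
  exists P, delta * c * mass N x P <= mass N x S /\
            mass N y S <= gamma * mass N y P.
Proof.
have [d0 d1] := andP delta01; have [g0 g1] := andP gamma01.
elim: N x y S => [|N IH] x y S ex hS.
  exists pred0; move: hS => /=; case: ifP => _ hS; last by rewrite !mulr0.
  by exfalso; nra.
case: (pickP (fun a => delta * e (A a x) < mass N (A a x) (fun w => S (a :: w))))
    => [a ha|hall].
  (* The current cell is taken whole. The overfull child alone pays for its energy up to the factor
     [delta * c], while in the cell itself the proportion of [S] is still at most [delta], so that
     the dichotomy applies to [y]. *)
  exists predT; rewrite !mass_predT; split; last exact: mass_dichotomy hS.
  apply: le_trans (mass_child N x S a).
  have h1 := e_child a x.
  have h2 : rho * (delta * e (A a x)) <= rho * mass N (A a x) (fun w => S (a :: w)).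
    by rewrite ler_pM2l // ltW.
  by apply: le_trans h2; rewrite mulrCA -mulrA ler_pM2l.
have hP a : exists P : pred (seq T),
    delta * c * mass N (A a x) P <= mass N (A a x) (fun w => S (a :: w)) /\
    mass N (A a y) (fun w => S (a :: w)) <= gamma * mass N (A a y) P.
  by apply: IH; [exact: e_child_gt0 | rewrite leNgt hall].
have [P hPa] := fin_all_exists hP.
exists (fun w => if w is a :: w' then P a w' else false).
split; rewrite /= mulr_sumr; apply: ler_sum => a _; have [h1 h2] := hPa a.
  by rewrite mulrCA ler_pM2l.
by rewrite mulrCA ler_pM2l.
Qed.

(** Each passage from [S] to the [P] of [mass_stopping] multiplies the x-mass by at most
    [(delta * c)^-1] and gains a factor [gamma] for y; n passages with [gamma ^+ n <= beta]
    suffice. *)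
Lemma mass_abs_continuous beta : 0 < beta -> exists2 eps, 0 < eps &
  forall N x y S, 0 < e x -> mass N x S <= eps * e x -> mass N y S <= beta * e y.
Proof.
have [d0 d1] := andP delta01; have [g0 g1] := andP gamma01 => b0.
have step n : exists2 eps, 0 < eps & forall N x y S, 0 < e x ->
    mass N x S <= eps * e x -> mass N y S <= gamma ^+ n * e y.
  elim: n => [|n [eps eps0 IH]].
    by exists 1 => // N x y S _ _; rewrite expr0 mul1r mass_le.
  (* The bound [delta] gives access to [mass_stopping]; the other one makes the x-mass of [P] at
     most [eps * e x], as the induction hypothesis wants. *)
  exists (Num.min delta (eps * (delta * c))).
    by rewrite lt_min d0 !mulr_gt0.
  move=> N x y S ex hS.
  have [|P [h1 h2]] := @mass_stopping N x y S ex.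
    by apply: le_trans hS _; rewrite ler_wpM2r // ge_min lexx.
  apply: le_trans h2 _; rewrite exprS -mulrA ler_pM2l //; apply: (IH _ x) => //.
  rewrite -(ler_pM2l (mulr_gt0 d0 c_gt0)); apply: le_trans h1 _.
  apply: le_trans hS _; rewrite [leRHS]mulrA ler_wpM2r //.
  by rewrite [X in _ <= X]mulrC ge_min lexx orbT.
have [n hn] : exists n, gamma ^+ n <= beta.
  have ng : `|gamma| < 1 by rewrite gtr0_norm.
  have /cvgrPdist_le /(_ _ b0) [n _ hn] := cvg_expr ng.
  exists n; have := hn n (leqnn n).
  by rewrite /= sub0r normrN ger0_norm // exprn_ge0 // ltW.
have [eps eps0 h] := step n; exists eps => // N x y S ex hS.
by apply: le_trans (h N x y S ex hS) _; rewrite ler_wpM2r.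
Qed.
End TreeMass.

(** * The energy form of a triangle *)

Notation o0 := (@Ordinal 3 0 isT).
Notation o1 := (@Ordinal 3 1 isT).
Notation o2 := (@Ordinal 3 2 isT).

Lemma ord3P (P : 'I_3 -> Prop) : P o0 -> P o1 -> P o2 -> forall i, P i.
Proof.
move=> h0 h1 h2 [[|[|[|//]]] hi].
- by rewrite (_ : Ordinal hi = o0) //; apply: val_inj.
- by rewrite (_ : Ordinal hi = o1) //; apply: val_inj.
- by rewrite (_ : Ordinal hi = o2) //; apply: val_inj.
Qed.

Lemma sum3 (V : nmodType) (F : 'I_3 -> V) : \sum_i F i = F o0 + F o1 + F o2.
Proof.
rewrite !big_ord_recl big_ord0 addr0 addrA.
by congr (_ + _ + _); congr F; apply: val_inj.
Qed.

Section TriangleForm.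
Variable R : realFieldType.
Implicit Types x y : 'I_3 -> R.

Definition tri_form x y : R := 2^-1 * \sum_i \sum_j (x i - x j) * (y i - y j).

(** The outward normal derivative at the vertex [i]; [flux_pairing] is the corresponding Gauss-Green
    formula. *)
Definition flux i x : R := \sum_j (x i - x j).

Lemma tri_formE x y : tri_form x y =
  (x o0 - x o1) * (y o0 - y o1) + (x o0 - x o2) * (y o0 - y o2) +
  (x o1 - x o2) * (y o1 - y o2).
Proof. by rewrite /tri_form !sum3; field. Qed.

Lemma tri_form_ge0 x : 0 <= tri_form x x.
Proof. by rewrite tri_formE -!expr2 !addr_ge0 ?sqr_ge0. Qed.

Lemma tri_form_eq0 x : tri_form x x = 0 -> forall i j, x i = x j.
Proof.
rewrite tri_formE -!expr2 => h.
have s1 := sqr_ge0 (x o0 - x o1); have s2 := sqr_ge0 (x o0 - x o2).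
have s3 := sqr_ge0 (x o1 - x o2).
have a1 : x o0 - x o1 = 0 by apply/eqP; rewrite -sqrf_eq0; apply/eqP; lra.
have a2 : x o0 - x o2 = 0 by apply/eqP; rewrite -sqrf_eq0; apply/eqP; lra.
by do 2 (apply: ord3P); lra.
Qed.

Lemma tri_form_young s x y : 0 < s ->
  2 * `|tri_form x y| <= s * tri_form x x + s^-1 * tri_form y y.
Proof.
move=> s0; rewrite !tri_formE.
have key (a b : R) : 2 * `|a * b| <= s * (a * a) + s^-1 * (b * b).
  rewrite -subr_ge0 normrM.
  have -> : s * (a * a) + s^-1 * (b * b) - 2 * (`|a| * `|b|) =
      s * (`|a| - s^-1 * `|b|) ^+ 2.
    rewrite -[a * a]expr2 -[b * b]expr2 -(real_normK (num_real a)) -(real_normK (num_real b)).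
    by field; rewrite gt_eqF.
  by rewrite mulr_ge0 ?sqr_ge0 // ltW.
have k1 := key (x o0 - x o1) (y o0 - y o1).
have k2 := key (x o0 - x o2) (y o0 - y o2).
have k3 := key (x o1 - x o2) (y o1 - y o2).
have t1 := ler_normD ((x o0 - x o1) * (y o0 - y o1) + (x o0 - x o2) * (y o0 - y o2))
  ((x o1 - x o2) * (y o1 - y o2)).
have t2 := ler_normD ((x o0 - x o1) * (y o0 - y o1)) ((x o0 - x o2) * (y o0 - y o2)).
lra.
Qed.

(* The three fluxes sum to 0 and their squares to 3 tri_form x x. *)
Lemma flux_large i j x : i != j -> 0 < tri_form x x ->
  tri_form x x < 4 * flux i x ^+ 2 \/ tri_form x x < 4 * flux j x ^+ 2.
Proof.
rewrite tri_formE /flux => + h.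
have [//|h1] := ltP (((x o0 - x o1) * (x o0 - x o1) + (x o0 - x o2) * (x o0 - x o2) +
    (x o1 - x o2) * (x o1 - x o2))) (4 * (\sum_j (x i - x j)) ^+ 2); first by left.
move=> ij; right; rewrite ltNge; apply/negP => h2; move: ij h1 h2.
rewrite !sum3; set a := x o0 in h *; set b := x o1 in h *; set c := x o2 in h *.
by elim/ord3P: i; elim/ord3P: j => //= _; rewrite -/a -/b -/c => h1 h2; nra.
Qed.

(** Pigeonhole: by [flux_large] at most one of the three vertices is bad for x and at most one for
    y. *)
Lemma flux_common x y : 0 < tri_form x x -> 0 < tri_form y y ->
  exists i, tri_form x x < 4 * flux i x ^+ 2 /\ tri_form y y < 4 * flux i y ^+ 2.
Proof.
move=> hx hy.
have [a01 a02 a12] : [/\ o0 != o1, o0 != o2 & o1 != o2] by [].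
have [x0|x0] := ltP (tri_form x x) (4 * flux o0 x ^+ 2).
  have [y0|y0] := ltP (tri_form y y) (4 * flux o0 y ^+ 2); first by exists o0.
  have [|y1] := flux_large a01 hy; first by rewrite ltNge y0.
  have [|y2] := flux_large a02 hy; first by rewrite ltNge y0.
  by have [x1|x2] := flux_large a12 hx; [exists o1|exists o2].
have [|x1] := flux_large a01 hx; first by rewrite ltNge x0.
have [|x2] := flux_large a02 hx; first by rewrite ltNge x0.
by have [y1|y2] := flux_large a12 hy; [exists o1|exists o2].
Qed.

End TriangleForm.

(** * Quantitative non-singularity of two energy distributions *)

Section Dichotomy.
Variables (R : realType) (T : finType) (A : T -> ('I_3 -> R) -> 'I_3 -> R).
Variables (rho C : R) (corner : 'I_3 -> T).
Hypothesis rho_gt0 : 0 < rho.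
Hypothesis C_ge1 : 1 <= C.
Hypothesis form_split : forall x y,
  tri_form x y = \sum_a rho * tri_form (A a x) (A a y).
Hypothesis corner_flux : forall i x y, `|flux i x * flux i y| <=
  C * (`|tri_form x y| + `|rho * tri_form (A (corner i) x) (A (corner i) y)|).

Let e (x : 'I_3 -> R) := tri_form x x.
Let mass := mass A rho e.
Let e_split x : e x = \sum_a rho * e (A a x). Proof. exact: form_split. Qed.
Let e_ge0 x : 0 <= e x. Proof. exact: tri_form_ge0. Qed.

(** Young's inequality in each cell of level [N], with one weight on [S] and another on its
    complement: x may be small on the first set and y on the second. *)
Lemma tri_form_mass N s t x y S : 0 < s -> 0 < t ->
  2 * `|tri_form x y| <= s * mass N x S + s^-1 * mass N y S +
    (t * mass N x (fun w => ~~ S w) + t^-1 * mass N y (fun w => ~~ S w)).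
Proof.
move=> s0 t0; elim: N x y S => [|N IH] x y S /=.
  case: (S [::]); rewrite /= !mulr0 !addr0 ?add0r; exact: tri_form_young.
rewrite form_split.
apply: (@le_trans _ _ (\sum_a rho * (2 * `|tri_form (A a x) (A a y)|))).
  have -> : \sum_a rho * (2 * `|tri_form (A a x) (A a y)|) =
      2 * \sum_a `|rho * tri_form (A a x) (A a y)|.
    by rewrite mulr_sumr; apply: eq_bigr => a _; rewrite (normrM rho) (gtr0_norm rho_gt0) mulrCA.
  rewrite ler_pM2l //; exact: ler_norm_sum.
rewrite !mulr_sumr -!big_split /=; apply: ler_sum => a _.
rewrite !(mulrCA _ rho) -!mulrDr ler_pM2l //; exact: IH.
Qed.

(** With this value the flux products are at most [C * (4 / t0) * X * Y], that is X Y / 4, where X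
    and Y are the square roots of the two energies; [flux_common] excludes exactly this. *)
Let t0 := 16 * C.
Let delta := t0^-2.

(* If S carried almost no energy of x and almost all the energy of y, then x and
   y would be almost orthogonal, both on the whole triangle and on its three
   corner cells; all products of their fluxes would then be small, against
   flux_common. *)
Lemma mass_dichotomy : [/\ 0 < delta < 1, 0 < 1 - delta < 1 &
  forall N x y S, 0 < e x -> mass N x S <= delta * e x ->
    mass N y S <= (1 - delta) * e y].
Proof.
have t1 : 1 < t0 by move: C_ge1; rewrite /t0 => c1; lra.
have tp : 0 < t0 by lra.
have C1 : 1 <= C := C_ge1.
have d0 : 0 < delta by rewrite invr_gt0 exprn_gt0.
have d1 : delta < 1 by rewrite invf_lt1 ?exprn_gt0 // exprn_egt1.
split; [by rewrite d0 | by apply/andP; split; lra |].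
move=> [|N] x y S ex hx.
  move: hx => /=; case: (S [::]) => h; last by rewrite mulr_ge0 //; lra.
  by exfalso; nra.
rewrite leNgt; apply/negP => hy.
have hyC := massC e_split N.+1 y S; have hyl := mass_le rho_gt0 e_ge0 e_split N.+1 y S.
rewrite -/mass in hyC hyl.
have ey : 0 < e y.
  rewrite lt_def e_ge0 andbT; apply/eqP => h; rewrite h in hy hyl; lra.
have hyS : mass N.+1 y (fun w => ~~ S w) <= delta * e y by lra.
have hxC := mass_le rho_gt0 e_ge0 e_split N.+1 x (fun w => ~~ S w).
rewrite -/mass in hxC.
pose X := Num.sqrt (e x); pose Y := Num.sqrt (e y).
have X0 : 0 < X by rewrite sqrtr_gt0.
have Y0 : 0 < Y by rewrite sqrtr_gt0.
have EX : e x = X ^+ 2 by rewrite sqr_sqrtr.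
have EY : e y = Y ^+ 2 by rewrite sqr_sqrtr.
(* On [S] the energy of x is at most [delta * X ^+ 2], off [S] that of y is at most
   [delta * Y ^+ 2]; these weights make each of the four Young terms at most X Y / [t0]. *)
pose s := t0 * (Y / X); pose t := t0^-1 * (Y / X).
have s0 : 0 < s by rewrite mulr_gt0 ?divr_gt0.
have tt0 : 0 < t by rewrite mulr_gt0 ?divr_gt0 ?invr_gt0.
have bound a b a' b' : a <= delta * e x -> b <= e y -> a' <= e x -> b' <= delta * e y ->
   s * a + s^-1 * b + (t * a' + t^-1 * b') <= 4 * t0^-1 * (X * Y).
  move=> h1 h2 h3 h4.
  have g1 : s * a <= t0^-1 * (X * Y).
    apply: (@le_trans _ _ (s * (delta * e x))); first by rewrite ler_pM2l.
    rewrite le_eqVlt; apply/orP; left; apply/eqP; rewrite EX /s /delta.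
    by field; rewrite !gt_eqF.
  have g2 : s^-1 * b <= t0^-1 * (X * Y).
    apply: (@le_trans _ _ (s^-1 * e y)); first by rewrite ler_pM2l ?invr_gt0.
    rewrite le_eqVlt; apply/orP; left; apply/eqP; rewrite EY /s.
    by field; rewrite !gt_eqF.
  have g3 : t * a' <= t0^-1 * (X * Y).
    apply: (@le_trans _ _ (t * e x)); first by rewrite ler_pM2l.
    rewrite le_eqVlt; apply/orP; left; apply/eqP; rewrite EX /t.
    by field; rewrite !gt_eqF.
  have g4 : t^-1 * b' <= t0^-1 * (X * Y).
    apply: (@le_trans _ _ (t^-1 * (delta * e y))); first by rewrite ler_pM2l ?invr_gt0.
    rewrite le_eqVlt; apply/orP; left; apply/eqP; rewrite EY /t /delta.
    by field; rewrite !gt_eqF.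
  lra.
have B1 : `|tri_form x y| <= 2 * t0^-1 * (X * Y).
  have := tri_form_mass N.+1 x y S s0 tt0.
  by have := bound _ _ _ _ hx hyl hxC hyS; lra.
have B2 i : `|rho * tri_form (A (corner i) x) (A (corner i) y)| <= 2 * t0^-1 * (X * Y).
  rewrite (normrM rho) gtr0_norm //.
  have := tri_form_mass N (A (corner i) x) (A (corner i) y) (fun w => S (corner i :: w)) s0 tt0.
  rewrite -(ler_pM2l rho_gt0) !mulrDr !(mulrCA rho).
  have m1 := le_trans (mass_child A rho_gt0 e_ge0 N x S (corner i)) hx.
  have m2 := le_trans (mass_child A rho_gt0 e_ge0 N y S (corner i)) hyl.
  have m3 := le_trans (mass_child A rho_gt0 e_ge0 N x (fun w => ~~ S w) (corner i)) hxC.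
  have m4 := le_trans (mass_child A rho_gt0 e_ge0 N y (fun w => ~~ S w) (corner i)) hyS.
  by have := bound _ _ _ _ m1 m2 m3 m4; rewrite /mass; lra.
have [i [h1 h2]] := flux_common ex ey.
have := corner_flux i x y; have := B2 i => b2 b3.
have b4 : `|flux i x * flux i y| <= 4^-1 * (X * Y).
  apply: le_trans b3 _; apply: (@le_trans _ _ (C * (4 * t0^-1 * (X * Y)))).
    by rewrite ler_pM2l; lra.
  rewrite le_eqVlt; apply/orP; left; apply/eqP; rewrite /t0; field.
  by rewrite gt_eqF //; lra.
have : (flux i x * flux i y) ^+ 2 <= (4^-1 * (X * Y)) ^+ 2.
  by rewrite -[X in X <= _]real_normK ?num_real // lerXn2r ?nnegrE // ltW ?mulr_gt0 ?invr_gt0.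
rewrite -/(e x) EX in h1; rewrite -/(e y) EY in h2.
have X20 : 0 < X ^+ 2 by rewrite exprn_gt0.
have Y20 : 0 < Y ^+ 2 by rewrite exprn_gt0.
have : X ^+ 2 * Y ^+ 2 < (4 * flux i x ^+ 2) * (4 * flux i y ^+ 2) by rewrite ltr_pM ?ltW.
rewrite !exprMn; lra.
Qed.

End Dichotomy.

(** * Harmonic functions on the triangular grid *)

(* The pair (i, j) with i + j <= k stands for the vertex of V_1 with barycentric
   coordinates (i, j, k - i - j) / k. *)

Section Grid.
Variables (R : realFieldType) (k : nat).
Hypothesis hk : (2 <= k)%N.
Implicit Types (U : nat -> nat -> R) (i j : nat).

Definition noncorner i j : bool := [&& i + j <= k, i < k, j < k & 0 < i + j]%N.

Definition grid_nbr i j i' j' : bool :=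
  [|| (i' == i.+1) && (j' == j), (i' == i) && (j' == j.+1),
      (i == i'.+1) && (j' == j), (i' == i) && (j == j'.+1),
      (i == i'.+1) && (j' == j.+1) | (i' == i.+1) && (j == j'.+1)]%N.

(** Each bracket is one level-1 cell at (i, j), of which there are three in the interior and two on
    the sides, and holds its two other vertices. Grouping by cells treats interior and side vertices
    alike and matches the sums of fluxes over cells. *)
Definition grid_laplacian U i j : R :=
  (if (i + j < k)%N then (U i.+1 j - U i j) + (U i j.+1 - U i j) else 0) +
  (if (0 < i)%N then (U i.-1 j - U i j) + (U i.-1 j.+1 - U i j) else 0) +
  (if (0 < j)%N then (U i j.-1 - U i j) + (U i.+1 j.-1 - U i j) else 0).

Definition grid_harmonic U : Prop :=
  forall i j, noncorner i j -> grid_laplacian U i j = 0.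

(** A path to (k - 1, 0) avoids the corners: increase i along the row, and once on the side i + j =
    k slide along it. As [grid_nbr] is symmetric, [P] can be carried both ways. *)
Lemma noncorner_connected (P : nat -> nat -> Prop) i j i' j' :
  (forall a b a' b', noncorner a b -> noncorner a' b' -> grid_nbr a b a' b' ->
     P a b -> P a' b') ->
  noncorner i j -> noncorner i' j' -> P i j -> P i' j'.
Proof.
move=> HP.
have to_end a b : noncorner a b -> P a b <-> P k.-1 0%N.
  have [n] := ubnP (k - a)%N; elim: n a b => // n IH a b hn hab.
  have sym a' b' : noncorner a' b' -> grid_nbr a b a' b' -> P a b <-> P a' b'.
    move=> h1 h2; split; apply: HP => //; move: h2; rewrite /grid_nbr; lia.
  have [ha|ha] := ltnP a k.-1; last first.
    have [->|hb] := posnP b.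
      by have -> : a = k.-1 by move: hab; rewrite /noncorner; lia.
    have E : a = k.-1 /\ b = 1%N by move: hab; rewrite /noncorner; lia.
    by apply: sym; rewrite /noncorner /grid_nbr; lia.
  have [hb|hb] := ltnP (a + b) k.
    have h1 : noncorner a.+1 b by move: hab; rewrite /noncorner; lia.
    rewrite (sym _ _ h1) /grid_nbr ?eqxx //.
    by apply: IH h1; lia.
  have h1 : noncorner a.+1 b.-1 by move: hab; rewrite /noncorner; lia.
  rewrite (sym _ _ h1); last by move: hab; rewrite /noncorner /grid_nbr; lia.
  by apply: IH h1; lia.
by move=> h1 h2 /(to_end _ _ h1) /(to_end _ _ h2).
Qed.

Lemma min_grid_nbr U m i j i' j' : grid_harmonic U ->
  (forall a b, (a + b <= k)%N -> m <= U a b) -> noncorner i j -> U i j = m ->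
  (i' + j' <= k)%N -> grid_nbr i j i' j' -> U i' j' = m.
Proof.
move=> hU hm hij Uij hv hn; have := hU i j hij; rewrite /grid_laplacian Uij.
have nn a b : (a + b <= k)%N -> 0 <= U a b - m by move=> /hm; lra.
have hs := hij; rewrite /noncorner in hs.
have p1 : 0 <= (if (i + j < k)%N then (U i.+1 j - m) + (U i j.+1 - m) else 0).
  by case: ifP => // c; apply: addr_ge0; apply: nn; lia.
have p2 : 0 <= (if (0 < i)%N then (U i.-1 j - m) + (U i.-1 j.+1 - m) else 0).
  by case: ifP => // c; apply: addr_ge0; apply: nn; lia.
have p3 : 0 <= (if (0 < j)%N then (U i j.-1 - m) + (U i.+1 j.-1 - m) else 0).
  by case: ifP => // c; apply: addr_ge0; apply: nn; lia.
move=> h0.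
have z1 : (if (i + j < k)%N then (U i.+1 j - m) + (U i j.+1 - m) else 0) = 0 by lra.
have z2 : (if (0 < i)%N then (U i.-1 j - m) + (U i.-1 j.+1 - m) else 0) = 0 by lra.
have z3 : (if (0 < j)%N then (U i j.-1 - m) + (U i.+1 j.-1 - m) else 0) = 0 by lra.
clear p1 p2 p3 h0.
have {z1} z1 : (i + j < k)%N -> U i.+1 j = m /\ U i j.+1 = m.
  move=> c; move: z1; rewrite c; have := nn i.+1 j ltac:(lia).
  by have := nn i j.+1 ltac:(lia) => *; split; lra.
have {z2} z2 : (0 < i)%N -> U i.-1 j = m /\ U i.-1 j.+1 = m.
  move=> c; move: z2; rewrite c; have := nn i.-1 j ltac:(lia).
  by have := nn i.-1 j.+1 ltac:(lia) => *; split; lra.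
have {z3} z3 : (0 < j)%N -> U i j.-1 = m /\ U i.+1 j.-1 = m.
  move=> c; move: z3; rewrite c; have := nn i j.-1 ltac:(lia).
  by have := nn i.+1 j.-1 ltac:(lia) => *; split; lra.
case/or4P: hn => [||| /or3P []] /andP [/eqP a /eqP b].
- by rewrite a b; apply z1; lia.
- by rewrite a b; apply z1; lia.
- by (have -> : i' = i.-1 by lia); rewrite b; apply z2; lia.
- by (have -> : j' = j.-1 by lia); rewrite a; apply z3; lia.
- by (have -> : i' = i.-1 by lia); rewrite b; apply z2; lia.
- by (have -> : j' = j.-1 by lia); rewrite a; apply z3; lia.
Qed.

Lemma min_everywhere U m i j : grid_harmonic U ->
  (forall a b, (a + b <= k)%N -> m <= U a b) -> noncorner i j -> U i j = m ->
  [/\ U k 0%N = m, U 0%N k = m & U 0%N 0%N = m].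
Proof.
move=> hU hm hij Uij.
have all_m a b : noncorner a b -> U a b = m.
  move=> hab; apply: (noncorner_connected (P := fun a b => U a b = m)) Uij => //.
  move=> {hab} a1 b1 a2 b2 h1 h2 h3 h4; apply: min_grid_nbr h3 => //.
  by case/and4P: h2.
split; [have h := all_m k.-1 0%N|have h := all_m 0%N k.-1|have h := all_m 1%N 0%N].
all: apply: (min_grid_nbr _ hm _ (h _)); rewrite ?/noncorner ?/grid_nbr //; lia.
Qed.

Lemma grid_ge0 U : grid_harmonic U ->
  0 <= U k 0%N -> 0 <= U 0%N k -> 0 <= U 0%N 0%N ->
  forall i j, (i + j <= k)%N -> 0 <= U i j.
Proof.
move=> hU u1 u2 u3.
pose V (p : 'I_k.+1 * 'I_k.+1) := (p.1 + p.2 <= k)%N.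
have V0 : V (ord0, ord0) by rewrite /V.
case: (@Order.TotalTheory.arg_minP _ _ _ (ord0, ord0) V (fun p => U p.1 p.2) V0) => -[a b].
rewrite /V /= => hab hmin.
have hm i j : (i + j <= k)%N -> U a b <= U i j.
  move=> hij; have hi : (i < k.+1)%N by lia.
  have hj : (j < k.+1)%N by lia.
  exact: (hmin (Ordinal hi, Ordinal hj) hij).
suff : 0 <= U a b by move=> h i j /hm; apply: le_trans.
have [nc|nc] := boolP (noncorner a b).
  by have [<- _ _] := min_everywhere hU hm nc erefl.
have : ((a : nat) = k /\ (b : nat) = 0%N) \/ ((a : nat) = 0%N /\ (b : nat) = k) \/
  ((a : nat) = 0%N /\ (b : nat) = 0%N) by move: nc; rewrite /noncorner; lia.
by move=> [[-> ->]|[[-> ->]|[-> ->]]].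
Qed.

Lemma grid_gt0 U i j : grid_harmonic U ->
  0 <= U k 0%N -> 0 <= U 0%N k -> 0 <= U 0%N 0%N ->
  0 < U k 0%N + U 0%N k + U 0%N 0%N ->
  noncorner i j -> 0 < U i j.
Proof.
move=> hU u1 u2 u3 us hij; have hm := grid_ge0 hU u1 u2 u3.
rewrite lt_def hm ?andbT; last by case/and4P: hij.
by apply/eqP => h; have [h1 h2 h3] := min_everywhere hU hm hij h; lra.
Qed.

Lemma grid_unique U U' : grid_harmonic U -> grid_harmonic U' ->
  U k 0%N = U' k 0%N -> U 0%N k = U' 0%N k -> U 0%N 0%N = U' 0%N 0%N ->
  forall i j, (i + j <= k)%N -> U i j = U' i j.
Proof.
have main V V' : grid_harmonic V -> grid_harmonic V' ->
    V k 0%N = V' k 0%N -> V 0%N k = V' 0%N k -> V 0%N 0%N = V' 0%N 0%N ->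
    forall i j, (i + j <= k)%N -> V' i j <= V i j.
  move=> h h' e1 e2 e3 i j hij; rewrite -subr_ge0.
  apply: (@grid_ge0 (fun i j => V i j - V' i j)) => //; try by lra.
  move=> a b hab; have := h a b hab; have := h' a b hab.
  by rewrite /grid_laplacian; do 3 case: ifP => _; lra.
move=> h h' e1 e2 e3 i j hij; apply: le_anti.
by rewrite !main.
Qed.

End Grid.

(** * Sign changes around one vertex *)

Section SignChanges.

Definition allb (f : bool -> bool) := f true && f false.

Lemma allbP f : allb f -> forall b, f b.
Proof. by case/andP => ? ? []. Qed.

(* The neighbours of (i, j) in cyclic order are (i+1, j), (i, j+1), (i-1, j+1),
   (i-1, j), (i, j-1), (i+1, j-1); a triangle at (i, j) exists when the
   corresponding condition on x = (0 < i), y = (0 < j), z = (i + j < k) holds. *)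
Definition sign_changes (x y z b1 b2 b3 b4 b5 b6 : bool) : nat :=
  (z && (b1 (+) b2)) + (x && z && (b2 (+) b3)) + (x && (b3 (+) b4)) +
  (x && y && (b4 (+) b5)) + (y && (b5 (+) b6)) + (y && z && (b6 (+) b1)).

(* The bits g and q tell which neighbours are strictly greater and which are
   equal; ties are broken by the signs s of a linear form in the six lattice
   directions, which are opposite in opposite directions. *)
Definition local_check (x y z g1 g2 g3 g4 g5 g6 q1 q2 q3 q4 q5 q6 s1 s2 s3 : bool) :=
  let ref := (z + (x && y))%N in
  let sc (t1 t2 t3 : bool) := sign_changes x y z
    (g1 || q1 && t1) (g2 || q2 && t2) (g3 || q3 && t3)
    (g4 || q4 && ~~ t1) (g5 || q5 && ~~ t2) (g6 || q6 && ~~ t3) in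
  let up := [|| z && g1, z && g2, x && g3, x && g4, y && g5 | y && g6] in
  let l (g q : bool) := ~~ g && ~~ q in
  let down := [|| z && l g1 q1, z && l g2 q2, x && l g3 q3, x && l g4 q4,
                  y && l g5 q5 | y && l g6 q6] in
  [&& [|| x && y, x && z | y && z], ~~ (g1 && q1), ~~ (g2 && q2), ~~ (g3 && q3),
      ~~ (g4 && q4), ~~ (g5 && q5), ~~ (g6 && q6) & up == down] ==>
  (ref <= sc s1 s2 s3)%N &&
  (up && [|| [&& z, q1, q2 & s1 (+) s2], [&& x, q3, q4 & s3 (+) ~~ s1] |
             [&& y, q5, q6 & s2 (+) s3]] ==>
   (ref.+2 <= sc s1 s2 s3)%N || (ref.+2 <= sc (~~ s1) (~~ s2) (~~ s3))%N).

(** A check of 18 bits by enumeration. The reason for the excess: around the vertex, take a tied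
    pair with opposite tie-breaking bits and, among the other neighbours, a strictly greater and a
    strictly smaller one. In one of the two orientations of the pair the signs alternate through all
    four, which gives 4 changes on a full turn and 3 on a side. *)
Lemma local_checkP x y z g1 g2 g3 g4 g5 g6 q1 q2 q3 q4 q5 q6 s1 s2 s3 :
  local_check x y z g1 g2 g3 g4 g5 g6 q1 q2 q3 q4 q5 q6 s1 s2 s3.
Proof.
move: s3; apply: allbP; move: s2; apply: allbP; move: s1; apply: allbP.
move: q6; apply: allbP; move: q5; apply: allbP; move: q4; apply: allbP.
move: q3; apply: allbP; move: q2; apply: allbP; move: q1; apply: allbP.
move: g6; apply: allbP; move: g5; apply: allbP; move: g4; apply: allbP.
move: g3; apply: allbP; move: g2; apply: allbP; move: g1; apply: allbP.
move: z; apply: allbP; move: y; apply: allbP; move: x; apply: allbP.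
by vm_compute.
Qed.
End SignChanges.

Section VertexSums.
Variable k : nat.
Implicit Type F : nat -> nat -> nat.

Definition grid_sum (P : nat -> nat -> bool) F : nat :=
  \sum_(i < k.+1) \sum_(j < k.+1) if P i j then F i j else 0%N.

Definition is_vertex i j := (i + j <= k)%N.

Lemma eq_grid_sum P F P' F' :
  (forall i j, (i <= k)%N -> (j <= k)%N ->
     (if P i j then F i j else 0) = (if P' i j then F' i j else 0))%N ->
  grid_sum P F = grid_sum P' F'.
Proof.
by move=> h; apply: eq_bigr => i _; apply: eq_bigr => j _; apply: h; rewrite -ltnS.
Qed.

Lemma grid_sumD P F F' :
  grid_sum P (fun i j => F i j + F' i j)%N = (grid_sum P F + grid_sum P F')%N.
Proof.
rewrite /grid_sum -big_split; apply: eq_bigr => i _; rewrite -big_split.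
by apply: eq_bigr => j _; case: ifP.
Qed.

(** The shift from i to i + 1 moves a sum over triangles from one of their vertices to another. *)
Lemma grid_sum_row P F :
  (forall j, (j <= k)%N -> P k j = false) ->
  grid_sum P F = grid_sum (fun i j => (0 < i) && P i.-1 j)%N (fun i j => F i.-1 j).
Proof.
move=> hP; rewrite /grid_sum big_ord_recr [in RHS]big_ord_recl /=.
rewrite [X in (_ + X)%N = _]big1 ?addn0; last by move=> j _; rewrite hP // -ltnS.
by rewrite [X in _ = (X + _)%N]big1.
Qed.

Lemma grid_sum_tr P F :
  grid_sum P F = grid_sum (fun i j => P j i) (fun i j => F j i).
Proof. exact: exchange_big. Qed.

Lemma grid_sum_col P F :
  (forall i, (i <= k)%N -> P i k = false) ->
  grid_sum P F = grid_sum (fun i j => (0 < j) && P i j.-1)%N (fun i j => F i j.-1).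
Proof. by move=> hP; rewrite grid_sum_tr grid_sum_row // [RHS]grid_sum_tr. Qed.

Lemma grid_sum_point i0 j0 c : is_vertex i0 j0 ->
  grid_sum is_vertex (fun i j => if (i == i0) && (j == j0) then c else 0)%N = c.
Proof.
rewrite /is_vertex => h; have hi : (i0 < k.+1)%N by lia.
have hj : (j0 < k.+1)%N by lia.
rewrite /grid_sum (bigD1 (Ordinal hi)) //= (bigD1 (Ordinal hj)) //= h !eqxx /=.
rewrite !big1 ?addn0 //.
  move=> i hi'; rewrite big1 // => j _; case: ifP => // _.
  by rewrite (_ : (i == i0 :> nat) = false) //; apply/negbTE; move: hi'; rewrite -val_eqE.
move=> j hj'; case: ifP => // _.
by rewrite (_ : (j == j0 :> nat) = false) //; apply/negbTE; move: hj'; rewrite -val_eqE.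
Qed.

Lemma leq_grid_sum (P : nat -> nat -> bool) F F' :
  (forall i j, P i j -> F i j <= F' i j)%N -> (grid_sum P F <= grid_sum P F')%N.
Proof.
by move=> h; apply: leq_sum => i _; apply: leq_sum => j _; case: ifP => // /h.
Qed.

End VertexSums.

(** * The total index and the absence of saddles *)

Section Index.
Variables (R : realFieldType) (k : nat).
Hypothesis hk : (2 <= k)%N.
Variable U : nat -> nat -> R.
Implicit Types al be : int.

(* Lexicographic order: ties of U are broken by a linear form, so that even a
   locally constant U is ordered without critical points. *)
Definition glt al be i j i' j' : bool :=
  (U i j < U i' j') || (U i j == U i' j') &&
    (al * i%:Z + be * j%:Z < al * i'%:Z + be * j'%:Z).

Definition vertex_index al be i j : nat :=
  sign_changes (0 < i)%N (0 < j)%N (i + j < k)%N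
    (glt al be i j i.+1 j) (glt al be i j i j.+1) (glt al be i j i.-1 j.+1)
    (glt al be i j i.-1 j) (glt al be i j i j.-1) (glt al be i j i.+1 j.-1).

(** Equal to 1 when (i, j) lies between the two other points in the order. *)
Definition mid al be i j i1 j1 i2 j2 : nat :=
  glt al be i j i1 j1 (+) glt al be i j i2 j2.

Lemma glt_neg al be i j i' j' :
  al * i%:Z + be * j%:Z != al * i'%:Z + be * j'%:Z ->
  glt al be i' j' i j = ~~ glt al be i j i' j'.
Proof.
move=> h; rewrite /glt (eq_sym (U i' j')); case: ltgtP => //= _.
by move: h; case: ltgtP.
Qed.

Lemma glt_trans al be i1 j1 i2 j2 i3 j3 :
  glt al be i1 j1 i2 j2 -> glt al be i2 j2 i3 j3 -> glt al be i1 j1 i3 j3.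
Proof.
rewrite /glt => /orP [h1|/andP [/eqP h1 h2]] /orP [h3|/andP [/eqP h3 h4]].
- by rewrite (lt_trans h1 h3).
- by rewrite -h3 h1.
- by rewrite h1 h3.
- by rewrite h1 h3 eqxx (lt_trans h2 h4) orbT.
Qed.

Lemma mid_triangle al be i1 j1 i2 j2 i3 j3 :
  al * i1%:Z + be * j1%:Z != al * i2%:Z + be * j2%:Z ->
  al * i1%:Z + be * j1%:Z != al * i3%:Z + be * j3%:Z ->
  al * i2%:Z + be * j2%:Z != al * i3%:Z + be * j3%:Z ->
  (mid al be i1 j1 i2 j2 i3 j3 + mid al be i2 j2 i3 j3 i1 j1 +
   mid al be i3 j3 i1 j1 i2 j2)%N = 1%N.
Proof.
move=> h12 h13 h23; rewrite /mid (glt_neg h12) (glt_neg h13) (glt_neg h23).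
have t1 := @glt_trans al be i1 j1 i2 j2 i3 j3.
have t2 := @glt_trans al be i3 j3 i2 j2 i1 j1.
rewrite (glt_neg h12) (glt_neg h13) (glt_neg h23) in t2.
move: t1 t2; case: (glt _ _ i1 j1 i2 j2); case: (glt _ _ i1 j1 i3 j3);
  case: (glt _ _ i2 j2 i3 j3) => //= t1 t2; try by have := t1 isT isT.
by have := t2 isT isT.
Qed.

Let vsum := grid_sum k (is_vertex k).
(* The number of sign changes at a regular vertex: 2 in the interior and 1 on
   the sides. At the corners it is chosen to make the total equal to the number
   of triangles. *)
Let ref i j : nat := ((i + j < k) + ((0 < i) && (0 < j)))%N.

(* Double counting: every triangle has exactly one middle vertex, and it is at
   that vertex that the triangle contributes a sign change. *)
Lemma sum_vertex_index al be : al != 0 -> be != 0 -> al != be ->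
  vsum (vertex_index al be) = vsum ref.
Proof.
move=> ha hb hab.
(* [up] counts the cells, [dn] the inverted triangles between them, with vertices (i + 1, j), (i, j
   + 1) and (i + 1, j + 1). Their three corners each give the six terms of [sign_changes], after the
   shifts [e1] to [e6]. *)
have up : grid_sum k (fun i j => i + j < k)%N (fun i j =>
    mid al be i j i.+1 j i j.+1 + mid al be i.+1 j i j.+1 i j +
    mid al be i j.+1 i j i.+1 j)%N = grid_sum k (fun i j => i + j < k)%N (fun _ _ => 1%N).
  apply: eq_grid_sum => i j _ _; case: ifP => // _; apply: mid_triangle; lia.
have dn : grid_sum k (fun i j => i + j.+1 < k)%N (fun i j =>
    mid al be i.+1 j.+1 i j.+1 i.+1 j + mid al be i j.+1 i.+1 j i.+1 j.+1 +
    mid al be i.+1 j i.+1 j.+1 i j.+1)%N = grid_sum k (fun i j => i + j.+1 < k)%N (fun _ _ => 1%N).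
  apply: eq_grid_sum => i j _ _; case: ifP => // _; apply: mid_triangle; lia.
rewrite !grid_sumD in up dn.
have -> : vsum ref = (vsum (fun i j => (i + j < k)%N) +
    vsum (fun i j => (0 < i) && (0 < j)))%N by exact: grid_sumD.
have r1 : vsum (fun i j => (i + j < k)%N) = grid_sum k (fun i j => i + j < k)%N (fun _ _ => 1%N).
  by apply: eq_grid_sum => i j _ _; rewrite /is_vertex; do 2 case: ifP => //; lia.
have r2 : vsum (fun i j => (0 < i) && (0 < j))%N = grid_sum k (fun i j => i + j.+1 < k)%N (fun _ _ => 1%N).
  rewrite [RHS]grid_sum_row; last by move=> *; lia.
  rewrite [RHS]grid_sum_col; last by move=> *; lia.
  by apply: eq_grid_sum => i j _ _; rewrite /is_vertex; do 2 case: ifP => //; lia.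
rewrite r1 r2 -up -dn {r1 r2 up dn} /vsum /vertex_index.
rewrite /sign_changes !grid_sumD.
set t1 := grid_sum _ _ _; set t2 := grid_sum _ _ _; set t3 := grid_sum _ _ _.
set t4 := grid_sum _ _ _; set t5 := grid_sum _ _ _; set t6 := grid_sum _ _ _.
have e1 : grid_sum k (fun i j => i + j < k)%N (fun i j => mid al be i j i.+1 j i j.+1) = t1.
  apply: eq_grid_sum => i j _ _; rewrite /is_vertex /mid.
  by case: (ltnP (i + j) k) => [/ltnW ->|] //= _; case: ifP.
have e2 : grid_sum k (fun i j => i + j.+1 < k)%N
    (fun i j => mid al be i.+1 j i.+1 j.+1 i j.+1) = t2.
  rewrite grid_sum_row; last by move=> *; lia.
  apply: eq_grid_sum => -[|i] j _ _; rewrite /is_vertex /mid /=; first by case: ifP.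
  have -> : (i + j.+1 < k)%N = (i.+1 + j < k)%N by lia.
  by case: (ltnP (i.+1 + j) k) => [/ltnW ->|] //= _; case: ifP.
have e3 : grid_sum k (fun i j => i + j < k)%N
    (fun i j => mid al be i.+1 j i j.+1 i j) = t3.
  rewrite grid_sum_row; last by move=> *; lia.
  by apply: eq_grid_sum => -[|i] j _ _; rewrite /is_vertex /mid //=; case: ifP.
have e4 : grid_sum k (fun i j => i + j.+1 < k)%N
    (fun i j => mid al be i.+1 j.+1 i j.+1 i.+1 j) = t4.
  rewrite grid_sum_row; last by move=> *; lia.
  rewrite grid_sum_col; last by move=> *; lia.
  apply: eq_grid_sum => -[|i] [|j] _ _; rewrite /is_vertex /mid ?andbF //=;
    by rewrite ?if_same // -addSnnS.
have e5 : grid_sum k (fun i j => i + j < k)%N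
    (fun i j => mid al be i j.+1 i j i.+1 j) = t5.
  rewrite grid_sum_col; last by move=> *; lia.
  apply: eq_grid_sum => i [|j] _ _; rewrite /is_vertex /mid /=; first by case: ifP.
  by rewrite addnS.
have e6 : grid_sum k (fun i j => i + j.+1 < k)%N
    (fun i j => mid al be i j.+1 i.+1 j i.+1 j.+1) = t6.
  rewrite grid_sum_col; last by move=> *; lia.
  apply: eq_grid_sum => i [|j] _ _; rewrite /is_vertex /mid /=; first by case: ifP.
  by case: (ltnP (i + j.+1) k) => [/ltnW ->|] //= _; case: ifP.
rewrite e1 e2 e3 e4 e5 e6; lia.
Qed.

Hypothesis hU : grid_harmonic k U.

Definition const_triangle i j : Prop := U i.+1 j = U i j /\ U i j.+1 = U i j.

Definition grid_flat i j : Prop :=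
  [/\ (i + j < k)%N -> U i.+1 j = U i j /\ U i j.+1 = U i j,
      (0 < i)%N -> U i.-1 j = U i j /\ U i.-1 j.+1 = U i j &
      (0 < j)%N -> U i j.-1 = U i j /\ U i.+1 j.-1 = U i j].

Lemma gltE al be i j i' j' c :
  al * i'%:Z + be * j'%:Z - (al * i%:Z + be * j%:Z) = c ->
  glt al be i j i' j' = (U i j < U i' j') || (U i j == U i' j') && (0 < c).
Proof. by move=> <-; rewrite subr_gt0. Qed.

(** Bits of absent neighbours are junk, for instance at [i.-1] when i = 0, and never reach the
    count. *)
Lemma eq_sign_changes (x y z b1 b2 b3 b4 b5 b6 b1' b2' b3' b4' b5' b6' : bool) :
  (z -> b1 = b1' /\ b2 = b2') -> (x -> b3 = b3' /\ b4 = b4') ->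
  (y -> b5 = b5' /\ b6 = b6') ->
  sign_changes x y z b1 b2 b3 b4 b5 b6 = sign_changes x y z b1' b2' b3' b4' b5' b6'.
Proof.
rewrite /sign_changes; case: z => [/(_ isT) [<- <-]|_]; case: x => [/(_ isT) [<- <-]|_];
  by case: y => [/(_ isT) [<- <-]|_]; rewrite ?andbF.
Qed.

Lemma vertex_indexE al be i j : al != 0 -> be != 0 -> al != be ->
  vertex_index al be i j = sign_changes (0 < i)%N (0 < j)%N (i + j < k)%N
    ((U i j < U i.+1 j) || (U i j == U i.+1 j) && (0 < al))
    ((U i j < U i j.+1) || (U i j == U i j.+1) && (0 < be))
    ((U i j < U i.-1 j.+1) || (U i j == U i.-1 j.+1) && (0 < be - al))
    ((U i j < U i.-1 j) || (U i j == U i.-1 j) && ~~ (0 < al))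
    ((U i j < U i j.-1) || (U i j == U i j.-1) && ~~ (0 < be))
    ((U i j < U i.+1 j.-1) || (U i j == U i.+1 j.-1) && ~~ (0 < be - al)).
Proof.
move=> ha hb hab; apply: eq_sign_changes.
- by split; apply: gltE; lia.
- have -> : (~~ (0 < al)) = (0 < - al) by lia.
  by case: i => //= i _; split; apply: gltE; lia.
have -> : (~~ (0 < be)) = (0 < - be) by lia.
have -> : (~~ (0 < be - al)) = (0 < al - be) by lia.
by case: j => //= j _; split; apply: gltE; lia.
Qed.

Lemma sum_signs (x y z : bool) (d1 d2 d3 d4 d5 d6 : R) :
  (if z then d1 + d2 else 0) + (if x then d3 + d4 else 0) +
    (if y then d5 + d6 else 0) = 0 ->
  [|| z && (0 < d1), z && (0 < d2), x && (0 < d3), x && (0 < d4),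
      y && (0 < d5) | y && (0 < d6)] ->
  [|| z && (d1 < 0), z && (d2 < 0), x && (d3 < 0), x && (d4 < 0),
      y && (d5 < 0) | y && (d6 < 0)].
Proof.
move=> h u; apply: contraT; rewrite !negb_or !negb_and -!leNgt.
case: x y z h u => [] [] []; rewrite /= ?orbF => h u.
all: repeat case/andP => ?; try (move=> ?).
all: repeat (case/orP: u => u); lra.
Qed.

Let has_gt i j := [|| (i + j < k)%N && (U i j < U i.+1 j), (i + j < k)%N && (U i j < U i j.+1),
  (0 < i)%N && (U i j < U i.-1 j.+1), (0 < i)%N && (U i j < U i.-1 j),
  (0 < j)%N && (U i j < U i j.-1) | (0 < j)%N && (U i j < U i.+1 j.-1)].
Let has_lt i j := [|| (i + j < k)%N && (U i.+1 j < U i j), (i + j < k)%N && (U i j.+1 < U i j),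
  (0 < i)%N && (U i.-1 j.+1 < U i j), (0 < i)%N && (U i.-1 j < U i j),
  (0 < j)%N && (U i j.-1 < U i j) | (0 < j)%N && (U i.+1 j.-1 < U i j)].

Let has_gt_lt i j : noncorner k i j -> has_gt i j = has_lt i j.
Proof.
move=> nc; have := hU nc; rewrite /grid_laplacian => hL.
have hL' : (if (i + j < k)%N then (U i j - U i.+1 j) + (U i j - U i j.+1) else 0) +
  (if (0 < i)%N then (U i j - U i.-1 j.+1) + (U i j - U i.-1 j) else 0) +
  (if (0 < j)%N then (U i j - U i j.-1) + (U i j - U i.+1 j.-1) else 0) = 0.
  by move: hL; do 3 case: ifP => _; lra.
apply/idP/idP => h.
  have := @sum_signs (0 < i)%N (0 < j)%N (i + j < k)%N (U i.+1 j - U i j) (U i j.+1 - U i j)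
    (U i.-1 j.+1 - U i j) (U i.-1 j - U i j) (U i j.-1 - U i j) (U i.+1 j.-1 - U i j).
  rewrite !subr_gt0 !subr_lt0; apply=> //.
  by move: hL'; do 3 case: ifP => _; lra.
have := sum_signs hL'.
by rewrite !subr_gt0 !subr_lt0; apply.
Qed.

Let flat_of_not_gt i j : noncorner k i j -> ~~ has_gt i j -> grid_flat i j.
Proof.
move=> nc h; have h' := h; rewrite has_gt_lt // in h'.
move: h h'; rewrite /has_gt /has_lt !negb_or !negb_and -!leNgt.
case/and5P => a1 a2 a3 a4 /andP [a5 a6]; case/and5P => b1 b2 b3 b4 /andP [b5 b6].
split=> c; rewrite c /= in a1 a2 a3 a4 a5 a6 b1 b2 b3 b4 b5 b6;
  by split; apply: le_anti; apply/andP.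
Qed.

Let lt_neq_eq (a b : R) : ~~ (a < b) && ~~ (a == b) = (b < a).
Proof. by case: ltgtP. Qed.

Let not_lt_eq (a b : R) : ~~ ((a < b) && (a == b)).
Proof. by case: ltgtP. Qed.

(* If a triangle at (i, j) is constant and (i, j) has a strictly greater
   neighbour, one of the two ways of breaking the ties of that triangle turns
   (i, j) into a saddle. *)
Lemma local_index i j al be : noncorner k i j ->
  al != 0 -> be != 0 -> al != be ->
  (ref i j <= vertex_index al be i j)%N /\
  (has_gt i j &&
   [|| [&& (i + j < k)%N, U i j == U i.+1 j, U i j == U i j.+1 & (0 < al) (+) (0 < be)],
       [&& (0 < i)%N, U i j == U i.-1 j.+1, U i j == U i.-1 j & (0 < be - al) (+) ~~ (0 < al)] |
       [&& (0 < j)%N, U i j == U i j.-1, U i j == U i.+1 j.-1 & (0 < be) (+) (0 < be - al)]] ->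
   ((ref i j).+2 <= vertex_index al be i j)%N \/
   ((ref i j).+2 <= vertex_index (- al) (- be) i j)%N).
Proof.
move=> nc ha hb hab; have ha' : - al != 0 by lia.
have hb' : - be != 0 by lia.
have hab' : - al != - be by lia.
rewrite !vertex_indexE //.
have -> : (0 < - al) = ~~ (0 < al) by lia.
have -> : (0 < - be) = ~~ (0 < be) by lia.
have -> : (0 < - be - - al) = ~~ (0 < be - al) by lia.
have := @local_checkP (0 < i)%N (0 < j)%N (i + j < k)%N
  (U i j < U i.+1 j) (U i j < U i j.+1) (U i j < U i.-1 j.+1)
  (U i j < U i.-1 j) (U i j < U i j.-1) (U i j < U i.+1 j.-1)
  (U i j == U i.+1 j) (U i j == U i j.+1) (U i j == U i.-1 j.+1)
  (U i j == U i.-1 j) (U i j == U i j.-1) (U i j == U i.+1 j.-1)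
  (0 < al) (0 < be) (0 < be - al).
rewrite /local_check !not_lt_eq !lt_neq_eq -/(has_gt i j) -/(has_lt i j).
rewrite -has_gt_lt // eqxx andbT.
have -> : [|| (0 < i) && (0 < j), (0 < i) && (i + j < k) | (0 < j) && (i + j < k)]%N.
  by move: nc; rewrite /noncorner; lia.
rewrite implyTb => /andP [h1 /implyP h2]; split; first exact: h1.
by move=> /h2 /orP.
Qed.

(** The totals agree and no noncorner vertex falls below [ref]. The corners can lose at most 1, at
    (0, 0), since [ref] is 0 at the two others; an excess of 2 is thus impossible. *)
Let no_excess i j al be : noncorner k i j ->
  al != 0 -> be != 0 -> al != be -> ~ ((ref i j).+2 <= vertex_index al be i j)%N.
Proof.
move=> nc ha hb hab hex.
have v0 : is_vertex k i j by case/and4P: nc.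
have v00 : is_vertex k 0 0 by [].
have : (vsum (fun a b => ref a b + if (a == i) && (b == j) then 2 else 0) <=
        vsum (fun a b => vertex_index al be a b + if (a == 0) && (b == 0) then 1 else 0))%N.
  apply: leq_grid_sum => a b hab'.
  case: (boolP (noncorner k a b)) => [nab|nab].
    have [h _] := local_index nab ha hb hab.
    case: andP => [[/eqP ea /eqP eb]|_]; last by rewrite addn0 (leq_trans h) // leq_addr.
    by rewrite ea eb addn2 (leq_trans hex) // leq_addr.
  rewrite (_ : (a == i) && (b == j) = false); last first.
    by apply/negbTE; apply: contra nab => /andP [/eqP -> /eqP ->].
  have : (ref a b <= (a == 0) && (b == 0))%N.
    by move: nab hab'; rewrite /ref /noncorner /is_vertex; lia.
  by rewrite addn0; case: andP => _ h; apply: (leq_trans h); rewrite leq_addl.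
have -> : vsum (fun a b => ref a b + if (a == i) && (b == j) then 2 else 0)%N =
    (vsum ref + 2)%N.
  by rewrite -[X in (_ + X)%N](grid_sum_point 2 v0); exact: grid_sumD.
have -> : vsum (fun a b => vertex_index al be a b + if (a == 0) && (b == 0) then 1 else 0)%N =
    (vsum (vertex_index al be) + 1)%N.
  by rewrite -[X in (_ + X)%N](grid_sum_point 1 v00); exact: grid_sumD.
by rewrite sum_vertex_index //; lia.
Qed.

Let flat_of_const_triangle i j : noncorner k i j ->
  [\/ (i + j < k)%N /\ const_triangle i j,
      (0 < i)%N /\ const_triangle i.-1 j |
      (0 < j)%N /\ const_triangle i j.-1] -> grid_flat i j.
Proof.
move=> nc ht; apply: flat_of_not_gt => //; apply/negP => hg.
have [al [be [ha hb hab hx]]] : exists al be, [/\ al != 0, be != 0, al != be &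
   [|| [&& (i + j < k)%N, U i j == U i.+1 j, U i j == U i j.+1 & (0 < al) (+) (0 < be)],
       [&& (0 < i)%N, U i j == U i.-1 j.+1, U i j == U i.-1 j & (0 < be - al) (+) ~~ (0 < al)] |
       [&& (0 < j)%N, U i j == U i j.-1, U i j == U i.+1 j.-1 & (0 < be) (+) (0 < be - al)]]].
  (* The linear form must have opposite signs towards the two other vertices of the constant
     triangle: [al] and [be], or [be - al] and [- al], or [- be] and [al - be]. *)
  case: ht => -[c [e1 e2]].
  - by exists 1, (-1); split=> //; rewrite c e1 e2 eqxx.
  - exists 1, 2; split=> //; rewrite c; rewrite prednK // in e1.
    by rewrite e1 e2 eqxx /= orbT.
  - exists 2, 1; split=> //; rewrite c; rewrite prednK // in e2.
    by rewrite e1 e2 eqxx /= !orbT.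
have [_ h] := local_index nc ha hb hab.
have [||] := h _; first by rewrite hg hx.
  exact: no_excess.
apply: no_excess => //; lia.
Qed.

(** A constant cell makes its noncorner vertices flat, and flatness spreads through the connected
    set of noncorner vertices up to the corners. *)
Lemma grid_nondegenerate i j : (i + j < k)%N -> const_triangle i j ->
  U k 0%N = U 0%N 0%N /\ U 0%N k = U 0%N 0%N.
Proof.
move=> hij ht.
have [a [b [nab fab]]] : exists a b, noncorner k a b /\ grid_flat a b.
  case: (boolP (noncorner k i j)) => nc.
    by exists i, j; split => //; apply: flat_of_const_triangle => //; apply: Or31.
  exists i.+1, j; have nc' : noncorner k i.+1 j by move: nc; rewrite /noncorner; lia.
  by split => //; apply: flat_of_const_triangle => //; apply: Or32.
pose P a' b' := grid_flat a' b' /\ U a' b' = U a b.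
have hP a' b' : noncorner k a' b' -> P a' b'.
  move=> nab'; apply: (noncorner_connected hk (P := P) _ nab nab') => //.
  move=> {a' b' nab'} a1 b1 a2 b2 n1 n2 hn [[f1 f2 f3] e1].
  have v1 : (a1 + b1 <= k)%N by case/and4P: n1.
  have v2 : (a2 + b2 <= k)%N by case/and4P: n2.
  (* Every edge belongs to a cell. The cell containing this edge is constant because its first
     endpoint is flat, and it is also a cell at the second endpoint. *)
  have key : U a2 b2 = U a1 b1 /\
    [\/ (a2 + b2 < k)%N /\ const_triangle a2 b2,
      (0 < a2)%N /\ const_triangle a2.-1 b2 |
      (0 < b2)%N /\ const_triangle a2 b2.-1].
    rewrite /const_triangle.
    case/or4P: hn => [||| /or3P []] /andP [/eqP c /eqP d].
    - have [|g1 g2] := f1 _; first by lia.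
      by rewrite c d; split => //; apply: Or32; rewrite /= g1 g2.
    - have [|g1 g2] := f1 _; first by lia.
      by rewrite c d; split => //; apply: Or33; rewrite /= g1 g2.
    - subst a1 b2; have [|/= g1 g2] := f2 _; first by [].
      by split => //; apply: Or31; rewrite g1 g2; split=> //; lia.
    - subst b1 a2; have [|/= g1 g2] := f3 _; first by [].
      by split => //; apply: Or31; rewrite g1 g2; split=> //; lia.
    - subst a1 b2; have [|/= g1 g2] := f2 _; first by [].
      by split => //; apply: Or33; rewrite /= g1 g2; split.
    - subst b1 a2; have [|/= g1 g2] := f3 _; first by [].
      by split => //; apply: Or32; rewrite /= g1 g2; split.
  by split; [apply: flat_of_const_triangle => //; exact: key.2 | rewrite key.1].
have [[_ f2 _] e] : P 1%N 0%N by apply: hP; rewrite /noncorner; lia.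
have [[f1 _ _] e'] : P k.-1 0%N by apply: hP; rewrite /noncorner; lia.
have [[f1' _ _] e''] : P 0%N k.-1 by apply: hP; rewrite /noncorner; lia.
have [|g _] := f2 _; first by [].
have [|g' _] := f1 _; first by lia.
have [|_ g''] := f1' _; first by lia.
rewrite prednK in g'; last by lia.
rewrite prednK in g''; last by lia.
by rewrite /= in g; rewrite g g' g'' e e' e''.
Qed.

End Index.

HB.instance Definition _ (k : nat) := Finite.on (cell_index k).

(** * Words and cells *)

Section Words.
Variable T : finType.

Fixpoint words (n : nat) : seq (seq T) :=
  if n is n'.+1 then [seq a :: w | a <- enum T, w <- words n'] else [:: [::]].

Lemma mem_words n w : (w \in words n) = (size w == n).
Proof.
elim: n w => [|n IH] w; first by rewrite inE; case: w.
apply/allpairsP/idP => [[[a v] /= [_ hv ->]]|].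
  by rewrite /= eqSS -IH.
case: w => // a v; rewrite /= eqSS -IH => hv.
by exists (a, v); rewrite mem_enum.
Qed.

Lemma words_uniq n : uniq (words n).
Proof.
elim: n => // n IH; apply: allpairs_uniq => //; first exact: enum_uniq.
by move=> [a w] [b v] _ _ [-> ->].
Qed.

Lemma sum_wordsS (V : nmodType) n (F : seq T -> V) :
  \sum_(w <- words n.+1) F w = \sum_a \sum_(w <- words n) F (a :: w).
Proof. by rewrite big_allpairs_dep big_enum. Qed.

Lemma sum_words_cat (V : nmodType) n m (F : seq T -> V) :
  \sum_(w <- words (n + m)) F w =
  \sum_(u <- words n) \sum_(v <- words m) F (u ++ v).
Proof.
elim: n F => [|n IH] F; first by rewrite big_seq1.
by rewrite addSn !sum_wordsS; apply: eq_bigr => a _; rewrite IH.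
Qed.

End Words.

(** * Barycentric coordinates *)

Section Coordinates.
Variables (R : realType) (k : nat) (q : 'I_3 -> plane R).
Hypothesis hk : (2 <= k)%N.
Hypothesis hq : equilateral q.

(** With centroid o and side l, the formula is c_i(x) = 1/3 + (2 / l^2) <x - o, q_i - o>: in an
    equilateral triangle <q_i - o, q_j - o> is l^2 / 3 if i = j and - l^2 / 6 otherwise. *)
Lemma barycentric_coordinates : exists c : 'I_3 -> plane R -> R,
  [/\ forall i, continuous (c i),
      forall i (a : cell_index k) x,
        c i (cell_map q a x) = k%:R^-1 * (c i x + (val a i)%:R),
      forall i j, c i (q j) = (i == j)%:R &
      forall x, \sum_i c i x = 1].
Proof.
have [l l0 hl] := hq.
have dist i j : i != j ->
    (q i 0 0 - q j 0 0) ^+ 2 + (q i 0 1 - q j 0 1) ^+ 2 = l ^+ 2.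
  move=> /hl <-; rewrite /euclidean_dist sqr_sqrtr; last first.
    by apply: sumr_ge0 => t _; exact: sqr_ge0.
  by rewrite big_ord_recl big_ord1; congr (_ + (q i 0 _ - q j 0 _) ^+ 2); apply: val_inj.
have d01 : _ := @dist o0 o1 isT; have d02 : _ := @dist o0 o2 isT.
have d12 : _ := @dist o1 o2 isT.
pose o t : R := 3^-1 * \sum_i q i 0 t.
pose g i (x : plane R) : R :=
  2 / l ^+ 2 * (x 0 0 * (q i 0 0 - o 0) + x 0 1 * (q i 0 1 - o 1)).
pose b i : R := 3^-1 - 2 / l ^+ 2 * (o 0 * (q i 0 0 - o 0) + o 1 * (q i 0 1 - o 1)).
have lnz : l != 0 by rewrite gt_eqF.
have delta i j : g i (q j) + b i = (i == j)%:R.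
  suff : l ^+ 2 / 2 * (g i (q j) + b i) = l ^+ 2 / 2 * (i == j)%:R.
    by apply: mulfI; rewrite mulf_neq0 ?invr_eq0 ?pnatr_eq0 ?expf_neq0.
  have -> : l ^+ 2 / 2 * (g i (q j) + b i) = l ^+ 2 / 6 +
      ((q j 0 0 - o 0) * (q i 0 0 - o 0) + (q j 0 1 - o 1) * (q i 0 1 - o 1)).
    by rewrite /g /b; field.
  rewrite /o !sum3; elim/ord3P: i; elim/ord3P: j => /=; rewrite ?eqxx; lra.
have gadd i x y : g i (x + y) = g i x + g i y by rewrite /g !mxE; ring.
have gscale i s x : g i (s *: x) = s * g i x by rewrite /g !mxE; ring.
exists (fun i x => g i x + b i); split.
- have cM (s : R) (f : plane R -> R) : continuous f -> continuous (fun x => f x * s).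
    by move=> hf x; apply: continuousM; [exact: hf | exact: cst_continuous].
  move=> i; have c1 := cM (q i 0 0 - o 0) _ (@coord_continuous R 1 2 0 0).
  have c2 := cM (q i 0 1 - o 1) _ (@coord_continuous R 1 2 0 1).
  have c3 := cM (2 / l ^+ 2) _ (fun x => continuousD (c1 x) (c2 x)).
  move=> x; apply: continuousD; last exact: cst_continuous.
  rewrite (_ : g i = fun x => (x 0 0 * (q i 0 0 - o 0) + x 0 1 * (q i 0 1 - o 1)) * (2 / l ^+ 2)).
    exact: c3.
  by apply/funext => y; rewrite /g mulrC.
- move=> i a x; rewrite /cell_map /cell_shift gadd !gscale !sum3 !gadd !gscale.
  have G j : g i (q j) = (i == j)%:R - b i by rewrite -delta addrK.
  rewrite !G.
  have : ((val a o0)%:R + (val a o1)%:R + (val a o2)%:R + 1 = k%:R :> R).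
    have h : (val a o0 + val a o1 + val a o2)%N = k.-1.
      by have /eqP := valP a; rewrite sum3.
    by rewrite -!natrD h natr1 prednK //; lia.
  have k0 : k%:R != 0 :> R by rewrite pnatr_eq0; lia.
  move=> h; rewrite -h in k0 *; move: (b i) (g i x) => B X.
  elim/ord3P: i {G} => /=; rewrite ?eqxx /=; field; exact: k0.
- by move=> i j; rewrite delta.
move=> x; rewrite sum3 /g /b /o !sum3; field; exact: lnz.
Qed.

End Coordinates.

Lemma natr_inv01 (R : realType) k : (2 <= k)%N -> 0 <= (k%:R^-1 : R) < 1.
Proof.
by move=> hk; rewrite invr_ge0 ler0n /= invf_lt1 ?ltr1n // ltr0n ltnW.
Qed.

Lemma geometric_small (R : realType) (z D e : R) : 0 <= z < 1 -> 0 < e ->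
  exists n, D * z ^+ n < e.
Proof.
move=> /andP [z0 z1] e0; have nz : `|z| < 1 by rewrite ger0_norm.
have e1 : 0 < e / (`|D| + 1) by rewrite divr_gt0 // ltr_wpDl.
have /cvgrPdist_lt /(_ _ e1) [n _ hn] := cvg_expr nz.
exists n; have := hn n (leqnn n); rewrite /= sub0r normrN ger0_norm ?exprn_ge0 // => h.
apply: (@le_lt_trans _ _ ((`|D| + 1) * z ^+ n)).
  by rewrite ler_wpM2r ?exprn_ge0 // (le_trans (ler_norm D)) // lerDl.
by rewrite mulrC -ltr_pdivlMr // ltr_wpDl.
Qed.

Lemma closed_approx (R : realType) (V : normedModType R) (C : set V) x : closed C ->
  (forall e, 0 < e -> exists2 y, C y & `|x - y| < e) -> C x.
Proof.
move=> cC h; apply: cC => B /nbhs_ballP [e e0 hB].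
by have [y Cy xy] := h e e0; exists y; split => //; apply: hB; rewrite -ball_normE.
Qed.

Lemma corner_cell_exists k (hk : (2 <= k)%N) i : exists a : cell_index k,
  forall j, val a j = (if j == i then k.-1 else 0%N) :> nat.
Proof.
have h1 : (k.-1 < k)%N by lia.
have h0 : (0 < k)%N by lia.
pose f := [ffun j : 'I_3 => if j == i then Ordinal h1 else Ordinal h0].
have hf : (\sum_j f j == k.-1)%N.
  by rewrite (bigD1 i) //= ffunE eqxx big1 ?addn0 // => j /negbTE ji; rewrite ffunE ji.
by exists (exist _ f hf) => j; rewrite /= ffunE; case: ifP.
Qed.

(** * Cells and their intersections *)

Section Geometry.
Variables (R : realType) (k : nat) (q : 'I_3 -> plane R) (K : set (plane R)).
Variable c : 'I_3 -> plane R -> R.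
Implicit Types w u v : seq (cell_index k).
Hypothesis hk : (2 <= k)%N.
Hypothesis hK : is_gasket k q K.
Hypothesis c_cont : forall i, continuous (c i).
Hypothesis c_cell : forall i (a : cell_index k) x,
  c i (cell_map q a x) = k%:R^-1 * (c i x + (val a i)%:R).
Hypothesis c_q : forall i j, c i (q j) = (i == j)%:R.
Hypothesis c_sum : forall x, \sum_i c i x = 1.

Let k_gt0 : 0 < k%:R :> R. Proof. by rewrite ltr0n; lia. Qed.
Let k_neq0 : k%:R != 0 :> R. Proof. by rewrite gt_eqF. Qed.

Lemma cell_index_sum (a : cell_index k) : (\sum_i val a i)%N = k.-1.
Proof. by have /eqP := valP a. Qed.

(* The cell of w is the set of points with barycentric coordinates
   (base w + c) / k ^ size w, where c runs over those of the points of K. *)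
Fixpoint base (w : seq (cell_index k)) (i : 'I_3) : nat :=
  if w is a :: w' then (k ^ size w' * val a i + base w' i)%N else 0%N.

Lemma coord_word_map i w x :
  c i (word_map q w x) = (k%:R ^+ size w)^-1 * (c i x + (base w i)%:R).
Proof.
elim: w => [|a w IH] /=; first by rewrite expr0 invr1 mul1r addr0.
rewrite c_cell IH exprS invfM -mulrA; congr (_ * _).
rewrite natrD natrM natrX; field.
by rewrite expf_neq0.
Qed.

Lemma sum_base w : ((\sum_i base w i).+1 = k ^ size w)%N.
Proof.
elim: w => [|a w IH] /=; first by rewrite big1.
rewrite big_split /= -big_distrr /= cell_index_sum -addnS IH expnS.
move: (k ^ size w)%N => p; rewrite -[in RHS](prednK (ltnW hk)) mulSn.
by rewrite mulnC addnC.
Qed.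

Lemma base_lt w i : (base w i < k ^ size w)%N.
Proof. by rewrite -sum_base ltnS (bigD1 i) //= leq_addr. Qed.

(** The letters are the base-k digits of the numbers [base w i]. *)
Lemma base_inj w w' : size w = size w' -> base w =1 base w' -> w = w'.
Proof.
elim: w w' => [|a w IH] [|a' w'] //= [hs] hb.
have p0 : (0 < k ^ size w)%N by rewrite expn_gt0; lia.
have e i : val a i = val a' i :> nat /\ base w i = base w' i.
  have := hb i; rewrite -hs => h.
  have b1 := base_lt w i; have b2 := base_lt w' i; rewrite -hs in b2.
  have h1 := congr1 (divn^~ (k ^ size w)%N) h; have h2 := congr1 (modn^~ (k ^ size w)%N) h.
  move: h1 h2; rewrite /= !(mulnC (k ^ _)%N) !divnMDl // !modnMDl.
  by rewrite !divn_small // !addn0 !modn_small.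
congr (_ :: _); last by apply: IH => // i; exact: (e i).2.
by apply: val_inj; apply/ffunP => i; apply: val_inj; exact: (e i).1.
Qed.

Lemma word_map_cat (u v : seq (cell_index k)) x : word_map q (u ++ v) x = word_map q u (word_map q v x).
Proof. by elim: u => //= a u ->. Qed.

Lemma word_mapB (w : seq (cell_index k)) x y :
  word_map q w x - word_map q w y = (k%:R ^+ size w)^-1 *: (x - y).
Proof.
elim: w => [|a w IH] /=; first by rewrite expr0 invr1 scale1r.
by rewrite /cell_map opprD addrACA subrr addr0 -scalerBr IH scalerA exprS invfM.
Qed.

Lemma word_map_inj (w : seq (cell_index k)) : injective (word_map q w).
Proof.
move=> x y /eqP; rewrite -subr_eq0 word_mapB scaler_eq0 invr_eq0 expf_eq0.
by rewrite (negbTE k_neq0) andbF /= subr_eq0 => /eqP.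
Qed.

Lemma cell_map_cont (a : cell_index k) : continuous (cell_map q a).
Proof.
move=> x; apply: continuousD; last exact: cst_continuous.
exact: scaler_continuous.
Qed.

Lemma word_map_cont (w : seq (cell_index k)) : continuous (word_map q w).
Proof.
elim: w => [|a w IH] x /=; first exact: cvg_id.
by apply: continuous_comp; [exact: IH | exact: cell_map_cont].
Qed.

Lemma gasket_word (w : seq (cell_index k)) x : K x -> K (word_map q w x).
Proof.
have [_ _ E] := hK => Kx; elim: w => //= a w IH.
by rewrite E; exists a => //; exists (word_map q w x).
Qed.

(** The vertex is the fixed point of its corner map; iterating that map from any point of [K]
    converges to it, and [K] is closed. *)
Lemma gasket_vertex i : K (q i).
Proof.
have [[x Kx] cK _] := hK; have [a ha] := corner_cell_exists hk i.
have fixq : cell_map q a (q i) = q i.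
  rewrite /cell_map /cell_shift (bigD1 i) //= ha eqxx big1 => [|j /negbTE ji]; last first.
    by rewrite ha ji scale0r.
  rewrite addr0 scalerA -scalerDl -[X in X + _]mulr1 -mulrDr addrC natr1 prednK; last lia.
  by rewrite mulVf // scale1r.
have fixw n : word_map q (nseq n a) (q i) = q i by elim: n => //= n ->.
have cl := compact_closed (@norm_hausdorff _ _) cK.
apply: (closed_approx cl) => e e0.
have [n hn] := geometric_small `|q i - x| (natr_inv01 R hk) e0.
exists (word_map q (nseq n a) x); first exact: gasket_word.
rewrite -{1}(fixw n) word_mapB normrZ size_nseq mulrC -exprVn.
by rewrite normrX gtr0_norm ?invr_gt0.
Qed.

(** Let y minimize [c i] on [K] and write y as the image of some z in [K]: then c_i(y) >= c_i(z) / k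
    >= c_i(y) / k, which forces c_i(y) >= 0. *)
Lemma gasket_simplex i x : K x -> 0 <= c i x.
Proof.
have [K0 cK E] := hK.
have [|y Ky hmin] := @compact_EVT_min _ R (c i) K K0 cK.
  by apply: continuous_subspaceT; exact: c_cont.
have Ky' : K y by rewrite inE in Ky.
have {}hmin z : K z -> c i y <= c i z by move=> Kz; apply: hmin; rewrite inE.
move=> Kx; apply: le_trans (hmin _ Kx).
have := Ky'; rewrite {1}E => -[a _ [z Kz hz]].
have := hmin _ Kz; have : c i y = k%:R^-1 * (c i z + (val a i)%:R) by rewrite -hz c_cell.
have [ki0 ki1] := andP (natr_inv01 R hk); move=> h1 h2.
have a0 : 0 <= (val a i)%:R :> R by exact: ler0n.
have ki1' : 0 < k%:R^-1 :> R by rewrite invr_gt0.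
nra.
Qed.

Lemma simplex_word w x : (forall i, 0 <= c i x) -> forall i, 0 <= c i (word_map q w x).
Proof.
move=> h i; rewrite coord_word_map mulr_ge0 //.
by rewrite addr_ge0 ?h.
Qed.

Lemma vertex_simplex i j : 0 <= c i (q j).
Proof. by rewrite c_q. Qed.

(* The vertex does not depend on the common point: two cells of the same level
   share at most one point. *)
Lemma cell_intersection w w' : size w = size w' -> w <> w' ->
  exists i, forall y y', (forall l, 0 <= c l y) -> (forall l, 0 <= c l y') ->
    word_map q w y = word_map q w' y' -> forall l, c l y' = (l == i)%:R.
Proof.
move=> hs hw.
(* All bases of one level have the same coordinate sum, so two distinct ones are not comparable. In
   such a coordinate a common point has c_i(y') >= 1, and y' is then the vertex i. *)
have [i hi] : exists i, (base w' i < base w i)%N.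
  apply: contrapT => /forallNP h; apply: hw; apply: base_inj => //.
  have hle i : (base w i <= base w' i)%N by rewrite leqNgt; apply/negP.
  have e : (\sum_i base w i = \sum_i base w' i)%N.
    by apply: succn_inj; rewrite !sum_base hs.
  move=> i; apply/eqP; rewrite eqn_leq hle /= leqNgt; apply/negP => lti.
  suff : (\sum_i base w i < \sum_i base w' i)%N by rewrite e ltnn.
  rewrite (bigD1 i) //= [X in (_ < X)%N](bigD1 i) //= -addSn leq_add //.
  by apply: leq_sum.
exists i => y y' y0 y'0 e.
have ei : c i y + (base w i)%:R = c i y' + (base w' i)%:R.
  have := congr1 (c i) e; rewrite !coord_word_map hs.
  by apply: mulfI; rewrite invr_eq0 expf_neq0.
have hi' : (base w' i)%:R + 1 <= (base w i)%:R :> R by rewrite natr1 ler_nat.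
have ge1 : 1 <= c i y' by have := y0 i; lra.
have := c_sum y'; rewrite (bigD1 i) //= => hsum.
have rest0 : 0 <= \sum_(j | j != i) c j y' by apply: sumr_ge0.
have rest : \sum_(j | j != i) c j y' = 0 by lra.
move=> l; case: eqVneq => [->|li]; first by rewrite /=; lra.
have /psumr_eq0P := rest => h; exact: h.
Qed.

Lemma coord_vertex_inj i j w : (forall l, c l (word_map q w (q i)) = c l (word_map q w (q j))) ->
  i = j.
Proof.
move=> /(_ i); rewrite !coord_word_map => /mulfI h.
have := h _; rewrite invr_eq0 expf_neq0 // => /(_ isT) /addIr; rewrite !c_q eqxx.
by case: eqVneq => // _ /eqP; rewrite oner_eq0.
Qed.

Lemma edge_unique w w' i j i' j' : size w = size w' -> i != j ->
  word_map q w (q i) = word_map q w' (q i') ->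
  word_map q w (q j) = word_map q w' (q j') ->
  [/\ w = w', i = i' & j = j'].
Proof.
move=> hs ij e1 e2.
have [ww|ww] := pselect (w = w').
  subst w'; split => //; [apply: (@coord_vertex_inj _ _ w) | apply: (@coord_vertex_inj _ _ w)] => l.
    by rewrite e1.
  by rewrite e2.
exfalso; have ww' : w' <> w by move=> h; exact: ww.
have [l hl] := cell_intersection (esym hs) ww'.
have h1 := hl _ _ (vertex_simplex^~ i') (vertex_simplex^~ i) (esym e1).
have h2 := hl _ _ (vertex_simplex^~ j') (vertex_simplex^~ j) (esym e2).
move/eqP: ij; apply; apply: (@coord_vertex_inj _ _ [::]) => m /=.
by rewrite h1 h2.
Qed.

Lemma edge_in_cell u w v i j : size u = size w -> i != j ->
  (word_map q w @` K) (word_map q (u ++ v) (q i)) ->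
  (word_map q w @` K) (word_map q (u ++ v) (q j)) -> u = w.
Proof.
move=> hs ij [y Ky ey] [z Kz ez]; apply: contrapT => uw.
have uw' : w <> u by move=> h; exact: uw.
rewrite !word_map_cat in ey ez.
have [l hl] := cell_intersection (esym hs) uw'.
have h1 := hl _ _ (fun m => @gasket_simplex m _ Ky) (@simplex_word v _ (vertex_simplex^~ i)) ey.
have h2 := hl _ _ (fun m => @gasket_simplex m _ Kz) (@simplex_word v _ (vertex_simplex^~ j)) ez.
move/eqP: ij; apply; apply: (@coord_vertex_inj _ _ v) => m /=.
by rewrite h1 h2.
Qed.

Lemma cell_unique w w' y y' : size w = size w' ->
  (forall l, 0 <= c l y) -> (forall l, 0 <= c l y') ->
  ~ (exists i, forall l, c l y = (l == i)%:R) ->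
  word_map q w y = word_map q w' y' -> w = w'.
Proof.
move=> hs hy hy' ny e; apply: contrapT => ww; apply: ny.
have ww' : w' <> w by move=> h; exact: ww.
have [l hl] := cell_intersection (esym hs) ww'.
by exists l; apply: hl hy' hy (esym e).
Qed.

End Geometry.

(** * Edge sums as sums over words *)

Section EdgeSums.
Variables (R : realType) (k : nat) (q : 'I_3 -> plane R) (K : set (plane R)).
Hypothesis hk : (2 <= k)%N.
Hypothesis hq : equilateral q.
Implicit Types w : seq (cell_index k).

Definition cell_values (f : plane R -> R) w (i : 'I_3) : R := f (word_map q w (q i)).

(** By [edge_unique] an oriented edge is the same as a word with two distinct vertex numbers. The
    condition [P] covers both uses: edges inside a cell, and edges ending at a given vertex. *)
Lemma sum_adj m (P : plane R * plane R -> Prop) (G : plane R * plane R -> R) :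
  \sum_(e \in [set e | adj k q m e.1 e.2 /\ P e]) G e =
  \sum_(w <- words (cell_index k) m) \sum_i \sum_(j | i != j)
    (if `[< P (word_map q w (q i), word_map q w (q j)) >]
     then G (word_map q w (q i), word_map q w (q j)) else 0).
Proof.
have [c [cc c_cell c_q c_sum]] := barycentric_coordinates hk hq.
pose f (t : seq (cell_index k) * ('I_3 * 'I_3)) : plane R * plane R :=
  (word_map q t.1 (q t.2.1), word_map q t.1 (q t.2.2)).
pose r := [seq (w, ij) | w <- words (cell_index k) m, ij <- enum {: 'I_3 * 'I_3}].
pose s := [seq t <- r | (t.2.1 != t.2.2) && `[< P (f t) >]].
have mem_s t : (t \in s) = [&& size t.1 == m, t.2.1 != t.2.2 & `[< P (f t) >]].
  rewrite mem_filter andbC; case: t => w ij /=.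
  rewrite -mem_words; congr (_ && _); apply/allpairsP/idP.
    by move=> [[w' ij'] /= [h _ [-> _]]].
  by move=> h; exists (w, ij); rewrite mem_enum.
have s_uniq : uniq s.
  apply: filter_uniq; apply: allpairs_uniq; [exact: words_uniq | exact: enum_uniq |].
  by move=> [? ?] [? ?].
have f_inj : set_inj [set` s] f.
  move=> [w [i j]] [w' [i' j']]; rewrite !inE /= !mem_s /=.
  move=> /and3P [/eqP h1 h2 _] /and3P [/eqP h3 _ _] [e1 e2].
  have hs : size w = size w' by rewrite h1 h3.
  by have [-> -> ->] := edge_unique hk c_cell c_q c_sum hs h2 e1 e2.
have -> : [set e | adj k q m e.1 e.2 /\ P e] = f @` [set` s].
  apply/seteqP; split => [[x y] /= [[xy [w [hw [_ [i _ <-] ex] [_ [j _ <-] ey]]]] hP]|].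
    exists (w, (i, j)); last by rewrite /f /= ex ey.
    rewrite /= mem_s /= hw eqxx /f /= ex ey; apply/andP; split; last exact/asboolP.
    by apply: contra_notN xy => /eqP ij; rewrite -ex -ey ij.
  move=> _ [[w [i j]] /= + <-]; rewrite mem_s => /and3P [/eqP hw ij /asboolP hP] /=.
  split => //; split.
    move=> e; have [] := edge_unique hk c_cell c_q c_sum (erefl (size w)) ij erefl (esym e).
    by move=> _ _ /= ji; move: ij; rewrite ji eqxx.
  by exists w; split => //; [exists (q i) => //; exists i | exists (q j) => //; exists j].
rewrite fsbig_image; last exact: f_inj.
rewrite -fsbig_seq // big_filter big_mkcond big_allpairs_dep.
apply: eq_bigr => w _; rewrite big_enum /=.
under [RHS]eq_bigr do rewrite big_mkcond.
rewrite (pair_bigA _ (fun i j => if i != j then if `[< P (word_map q w (q i), word_map q w (q j)) >]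
     then G (word_map q w (q i), word_map q w (q j)) else 0 else 0)) /=.
by apply: eq_bigr => -[i j] _ /=; case: (i != j).
Qed.

Lemma edge_sumE m u v : edge_sum k q m setT u v =
  \sum_(w <- words (cell_index k) m) tri_form (cell_values u w) (cell_values v w).
Proof.
rewrite /edge_sum.
rewrite (_ : [set e | _] = [set e | adj k q m e.1 e.2 /\ True]); last first.
  by apply/seteqP; split => e /= => [[]|[]].
rewrite sum_adj mulr_sumr; apply: eq_bigr => w _.
rewrite /tri_form; congr (_ * _); apply: eq_bigr => i _.
rewrite [RHS](bigD1 i) //= subrr mul0r add0r.
under [LHS]eq_bigr do rewrite asboolT //.
by apply: eq_bigl => j; rewrite eq_sym.
Qed.

Lemma sub_sum3 (F : 'I_3 -> 'I_3 -> R) : (forall i, F i i = 0) ->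
  \sum_i \sum_(j | i != j) F i j = \sum_i \sum_j F i j.
Proof.
move=> F0; apply: eq_bigr => i _; rewrite [RHS](bigD1 i) //= F0 add0r.
by apply: eq_bigl => j; rewrite eq_sym.
Qed.

Hypothesis hK : is_gasket k q K.

Lemma edge_sum_cellE w m u v : edge_sum k q (size w + m) (word_map q w @` K) u v =
  \sum_(w' <- words (cell_index k) m)
    tri_form (cell_values u (w ++ w')) (cell_values v (w ++ w')).
Proof.
have [c [cc c_cell c_q c_sum]] := barycentric_coordinates hk hq.
rewrite /edge_sum.
pose A := word_map q w @` K.
rewrite (_ : [set e | _] = [set e | adj k q (size w + m) e.1 e.2 /\ (A e.1 /\ A e.2)]); last first.
  by apply/seteqP; split => e /= => [[? ? ?]|[? []]].
rewrite sum_adj sum_words_cat.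
rewrite (bigD1_seq w) /=; [|by rewrite mem_words|exact: words_uniq].
rewrite [X in _ + X]big_seq_cond [X in _ + X]big1 ?addr0; last first.
  move=> u' /andP [+ uw]; rewrite mem_words => /eqP hs.
  apply: big1 => w' _; apply: big1 => i _; apply: big1 => j ij.
  case: asboolP => // -[h1 h2]; move/eqP: uw; case.
  exact: (edge_in_cell hk hK cc c_cell c_q c_sum hs ij h1 h2).
rewrite mulr_sumr; apply: eq_bigr => w' _.
rewrite /tri_form -sub_sum3; last by move=> i; rewrite subrr mul0r.
congr (_ * _); apply: eq_bigr => i _; apply: eq_bigr => j _; rewrite asboolT //.
by split; rewrite word_map_cat; [exists (word_map q w' (q i)) | exists (word_map q w' (q j))] => //;
  apply: (gasket_word hK); exact: (gasket_vertex hk hK).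
Qed.

End EdgeSums.

Section GridCells.
Variable k : nat.
Hypothesis hk : (2 <= k)%N.

Lemma cell_sum3 (a : cell_index k) : (val a o0 + val a o1 + val a o2)%N = k.-1.
Proof. by have /eqP := valP a; rewrite sum3. Qed.

Lemma cell_ext (a b : cell_index k) :
  val a o0 = val b o0 :> nat -> val a o1 = val b o1 :> nat -> a = b.
Proof.
move=> h0 h1; have ha := cell_sum3 a; have hb := cell_sum3 b.
apply: val_inj; apply/ffunP => i; apply: val_inj; elim/ord3P: i => //=.
move: h0 h1 ha hb => /= ; lia.
Qed.

(** The condition stands inside the existential so that [cell_at] is total, with a junk value
    outside the triangle. *)
Lemma cell_at_exists i j : exists a : cell_index k, (i + j < k)%N ->
  val a o0 = i :> nat /\ val a o1 = j :> nat.
Proof.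
have [hij|hij] := ltnP (i + j) k; last first.
  by have [a _] := corner_cell_exists hk o0; exists a.
have h0 : (i < k)%N by lia.
have h1 : (j < k)%N by lia.
have h2 : (k.-1 - i - j < k)%N by lia.
pose f := [ffun l : 'I_3 => if l == o0 then Ordinal h0 else if l == o1 then Ordinal h1
  else Ordinal h2].
have hf : (\sum_l f l == k.-1)%N.
  rewrite sum3 !ffunE /=; apply/eqP; change (i + j + (k.-1 - i - j) = k.-1)%N; lia.
by exists (exist _ f hf) => _; rewrite /= !ffunE.
Qed.

Definition cell_at i j : cell_index k := projT1 (cid (cell_at_exists i j)).

Lemma cell_at0 i j : (i + j < k)%N -> val (cell_at i j) o0 = i :> nat.
Proof. by rewrite /cell_at; case: cid => a /= h /h []. Qed.

Lemma cell_at1 i j : (i + j < k)%N -> val (cell_at i j) o1 = j :> nat.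
Proof. by rewrite /cell_at; case: cid => a /= h /h []. Qed.

End GridCells.

Section GridPoints.
Variables (R : realType) (k : nat) (q : 'I_3 -> plane R).
Hypothesis hk : (2 <= k)%N.
Hypothesis hq : equilateral q.

Definition grid_point (i j : nat) : plane R :=
  k%:R^-1 *: (i%:R *: q o0 + j%:R *: q o1 + (k - i - j)%:R *: q o2).

Lemma cell_map_vertex (a : cell_index k) l :
  cell_map q a (q l) = grid_point (val a o0 + (l == o0)) (val a o1 + (l == o1)).
Proof.
have := cell_sum3 a; rewrite /grid_point /cell_map /cell_shift sum3 -scalerDr => h.
congr (_ *: _); elim/ord3P: l => /=; rewrite ?eqxx /= ?addn0 ?addn1.
- rewrite (_ : (k - _ - _)%N = val a o2); last by move: h => /=; lia.
  rewrite -natr1 scalerDl scale1r.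
  by rewrite [RHS](AC (2*1*1) (2*((1*3)*4))).
- rewrite (_ : (k - _ - _)%N = val a o2); last by move: h => /=; lia.
  rewrite -natr1 scalerDl scale1r.
  by rewrite [RHS](AC (1*2*1) (3*((1*2)*4))).
rewrite (_ : (k - _ - _)%N = (val a o2).+1); last by move: h => /=; lia.
by rewrite -natr1 scalerDl scale1r [LHS]addrC [RHS]addrA.
Qed.

Lemma vertex_cell i j : (i + j <= k)%N -> exists (a : cell_index k) l,
  [/\ (i = val a o0 + (l == o0))%N, (j = val a o1 + (l == o1))%N &
      grid_point i j = cell_map q a (q l)].
Proof.
move=> hij; have [h|h] := ltnP (i + j) k.
  exists (cell_at hk i j), o2; rewrite /= cell_map_vertex cell_at0 // cell_at1 //= !addn0.
  by split.
have [h0|h0] := posnP i.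
  exists (cell_at hk i j.-1), o1; rewrite /= cell_map_vertex cell_at0 ?cell_at1 /=; try lia.
  by rewrite addn0 addn1 prednK //; lia.
exists (cell_at hk i.-1 j), o0; rewrite /= cell_map_vertex cell_at0 ?cell_at1 /=; try lia.
by rewrite addn0 addn1 prednK //; lia.
Qed.

Lemma grid_point_q0 : grid_point k 0 = q o0.
Proof.
rewrite /grid_point subnn sub0n !scale0r !addr0 scalerA mulVf ?scale1r // pnatr_eq0; lia.
Qed.

Lemma grid_point_q1 : grid_point 0 k = q o1.
Proof.
rewrite /grid_point subn0 subnn !scale0r add0r addr0 scalerA mulVf ?scale1r // pnatr_eq0; lia.
Qed.

Lemma grid_point_q2 : grid_point 0 0 = q o2.
Proof.
rewrite /grid_point !subn0 !scale0r !add0r scalerA mulVf ?scale1r // pnatr_eq0; lia.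
Qed.

Section Coord.
Variable c : 'I_3 -> plane R -> R.
Hypothesis c_cell : forall i (a : cell_index k) x,
  c i (cell_map q a x) = k%:R^-1 * (c i x + (val a i)%:R).
Hypothesis c_q : forall i j, c i (q j) = (i == j)%:R.

Lemma coord_grid_point i j : (i + j <= k)%N ->
  c o0 (grid_point i j) = k%:R^-1 * i%:R /\ c o1 (grid_point i j) = k%:R^-1 * j%:R.
Proof.
move=> hij; have [a [l [hi hj ->]]] := vertex_cell hij.
by rewrite !c_cell !c_q hi hj !(eq_sym _ l) !natrD; split; congr (_ * _); rewrite addrC.
Qed.
End Coord.

Lemma grid_point_inj i j i' j' : (i + j <= k)%N -> (i' + j' <= k)%N ->
  grid_point i j = grid_point i' j' -> i = i' /\ j = j'.
Proof.
have [c [_ c_cell c_q _]] := barycentric_coordinates hk hq.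
move=> h h' e; have [e1 e2] := coord_grid_point c_cell c_q h.
have [] := coord_grid_point c_cell c_q h'; rewrite -e e1 e2.
have kn : k%:R^-1 != 0 :> R by rewrite invr_eq0 pnatr_eq0; lia.
by move=> /(mulfI kn) /eqP; rewrite eqr_nat => /eqP -> /(mulfI kn) /eqP; rewrite eqr_nat => /eqP ->.
Qed.

Lemma cell_map_vertex_eq (a : cell_index k) l i j : (i + j <= k)%N ->
  (cell_map q a (q l) == grid_point i j) =
  (val a o0 + (l == o0) == i)%N && (val a o1 + (l == o1) == j)%N.
Proof.
move=> hij; rewrite cell_map_vertex; apply/eqP/andP => [|[/eqP -> /eqP ->] //].
case/grid_point_inj => //; last by move=> -> ->.
have := cell_sum3 a => /= h; elim/ord3P: l => /=; lia.
Qed.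

(** A grid vertex is the vertex 2 of the cell at (i, j), the vertex 0 of the one at (i - 1, j) and
    the vertex 1 of the one at (i, j - 1), as far as these exist. *)
Lemma sum_at_vertex (H : cell_index k -> 'I_3 -> R) i j : (i + j <= k)%N ->
  \sum_a \sum_l (if cell_map q a (q l) == grid_point i j then H a l else 0) =
  (if (i + j < k)%N then H (cell_at hk i j) o2 else 0) +
  (if (0 < i)%N then H (cell_at hk i.-1 j) o0 else 0) +
  (if (0 < j)%N then H (cell_at hk i j.-1) o1 else 0).
Proof.
move=> hij; rewrite exchange_big /= sum3 addrC addrA.
have step l (b : bool) i' j' : (b -> i' + j' < k)%N ->
    (forall a : cell_index k, (val a o0 + (l == o0) == i)%N && (val a o1 + (l == o1) == j)%N =
       b && ((val a o0 == i' :> nat) && (val a o1 == j' :> nat))) ->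
    \sum_a (if cell_map q a (q l) == grid_point i j then H a l else 0) =
    if b then H (cell_at hk i' j') l else 0.
  move=> hb hab; under eq_bigr => a _ do rewrite cell_map_vertex_eq // hab.
  case: b hb {hab} => [/(_ isT) h|_] /=; last by rewrite big1.
  rewrite (bigD1 (cell_at hk i' j')) //= cell_at0 // cell_at1 // !eqxx /= big1 ?addr0 //.
  move=> a /eqP ha; case: ifP => // /andP [/eqP e0 /eqP e1]; case: ha.
  by apply: cell_ext; rewrite ?cell_at0 ?cell_at1.
congr (_ + _ + _); apply: step => [|a]; rewrite ?eqxx /=; try lia.
all: have := cell_sum3 a => /= h; lia.
Qed.

End GridPoints.

Lemma flux_pairing (R : realFieldType) (x y : 'I_3 -> R) :
  tri_form x y = \sum_i y i * flux i x.
Proof. by rewrite tri_formE /flux !sum3; ring. Qed.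

(** * Harmonicity on the gasket and on the grid *)

Section Harmonicity.
Variables (R : realType) (k : nat) (q : 'I_3 -> plane R) (K : set (plane R)).
Hypothesis hk : (2 <= k)%N.
Hypothesis hq : equilateral q.

Definition grid_values (u : plane R -> R) i j : R := u (grid_point k q i j).

Lemma sum_flux_vertex u i j : (i + j <= k)%N ->
  \sum_(a : cell_index k) \sum_l (if cell_map q a (q l) == grid_point k q i j
    then flux l (cell_values q u [:: a]) else 0) = - grid_laplacian k (grid_values u) i j.
Proof.
move=> hij; rewrite (sum_at_vertex hk hq (fun a l => flux l (cell_values q u [:: a]))) //.
rewrite /grid_laplacian !opprD; congr (_ + _ + _); case: ifP => c; rewrite ?oppr0 //.
- rewrite /flux sum3 /cell_values /= !cell_map_vertex // cell_at0 // cell_at1 //=.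
  by rewrite !addn0 !addn1 subrr addr0 opprD !opprB.
- rewrite /flux sum3 /cell_values /= !cell_map_vertex // cell_at0 ?cell_at1 //=; try lia.
  rewrite !addn0 !addn1 subrr add0r opprD !opprB prednK //.
  by rewrite addrC.
- rewrite /flux sum3 /cell_values /= !cell_map_vertex // cell_at0 ?cell_at1 //=; try lia.
  rewrite !addn0 !addn1 subrr addr0 opprD !opprB prednK //.
  by rewrite addrC.
Qed.

(** Tested against the indicator function of a noncorner grid point, the weak equation is the sum of
    the fluxes at that point. *)
Lemma weak_grid_harmonic u :
  (forall v : plane R -> R, (forall l, v (q l) = 0) ->
    \sum_(a : cell_index k) tri_form (cell_values q u [:: a]) (cell_values q v [:: a]) = 0) ->
  grid_harmonic k (grid_values u).
Proof.
move=> hu i j nc; have hij : (i + j <= k)%N by case/and4P: nc.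
apply/eqP; rewrite -oppr_eq0 -sum_flux_vertex //; apply/eqP.
pose v (x : plane R) : R := (x == grid_point k q i j)%:R.
rewrite -[RHS](hu v).
  apply: eq_bigr => a _; rewrite flux_pairing; apply: eq_bigr => l _.
  by rewrite /cell_values /v /=; case: ifP => _; rewrite ?mul1r ?mul0r.
move=> l; rewrite /v; case: eqP => // e; exfalso.
have [i' [j' [h' e' c']]] : exists i' j', [/\ (i' + j' <= k)%N, q l = grid_point k q i' j' &
    ~~ noncorner k i' j'].
  elim/ord3P: l {e}.
  - by exists k, 0%N; rewrite grid_point_q0 // /noncorner; split => //; lia.
  - by exists 0%N, k; rewrite grid_point_q1 // /noncorner; split => //; lia.
  - by exists 0%N, 0%N; rewrite grid_point_q2 // /noncorner; split => //; lia.
have [ei ej] := grid_point_inj hk hq h' hij (etrans (esym e') e).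
by move: c'; rewrite ei ej nc.
Qed.

Hypothesis hK : is_gasket k q K.

(** The image of a noncorner point [p] lies in no other cell of level [size w]; its neighbours one
    level further are thus all in the cell of [w], and harmonicity of [h] there is the grid equation
    at [p]. *)
Lemma gasket_harmonic_grid h (w : seq (cell_index k)) : gasket_harmonic k q K h ->
  grid_harmonic k (grid_values (h \o word_map q w)).
Proof.
move=> [_ hh] i j nc; have hij : (i + j <= k)%N by case/and4P: nc.
have [c [cc c_cell c_q c_sum]] := barycentric_coordinates hk hq.
have k0 : k%:R != 0 :> R by rewrite pnatr_eq0; lia.
set p := grid_point k q i j.
have p_simplex l : 0 <= c l p.
  have [a [l' [_ _ e]]] := vertex_cell q hk hij; rewrite /p e.
  by rewrite c_cell c_q mulr_ge0 ?invr_ge0 ?addr_ge0.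
have p_novertex : ~ (exists m, forall l, c l p = (l == m)%:R).
  move=> [m hm]; have [e0 e1] := coord_grid_point hk c_cell c_q hij.
  have ei : i%:R = k%:R * c o0 p :> R by rewrite e0 mulVKf.
  have ej : j%:R = k%:R * c o1 p :> R by rewrite e1 mulVKf.
  move: ei ej; rewrite !hm; move: nc; rewrite /noncorner -!natrM.
  move=> + /eqP + /eqP; rewrite !eqr_nat.
  by elim/ord3P: m {hm}; rewrite /= ?muln0 ?muln1; lia.
set X := word_map q w p.
have Xw : V k q (size w).+1 X.
  have [a [l [_ _ e]]] := vertex_cell q hk hij.
  exists (w ++ [:: a]); first by rewrite /= size_cat addn1.
  by exists (q l); [exists l | rewrite word_map_cat /X /p e].
(* If the image were the vertex m, each other coordinate of [p] would vanish, since it and that of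
   the base are nonnegative with sum 0; then [p] would be the vertex m. *)
have XV0 : ~ V0 q X.
  move=> [m _ hm]; apply: p_novertex.
  have cX l : c l X = (l == m)%:R by rewrite -hm c_q.
  exists m => l.
  have cw l' : (k%:R ^+ size w) * c l' X = c l' p + (base w l')%:R.
    by rewrite (coord_word_map hk c_cell) mulrA mulfV ?mul1r // expf_neq0.
  have [lm|lm] := eqVneq l m; last first.
    have := cw l; rewrite cX (negbTE lm) mulr0 => h0; apply/eqP.
    have := p_simplex l; have b0 : 0 <= (base w l)%:R :> R by [].
    rewrite mulr0n => p0; apply/eqP; lra.
  rewrite lm mulr1n.
  have rest l' : l' != m -> c l' p = 0.
    move=> l'm; have := cw l'; rewrite cX (negbTE l'm) mulr0 => h0.
    have := p_simplex l'; have b0 : 0 <= (base w l')%:R :> R by [].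
    by move=> p0; lra.
  by have := c_sum p; rewrite (bigD1 m) //= big1 ?addr0.
have := hh (size w).+1 X isT Xw XV0.
have -> : \sum_(y \in [set y | adj k q (size w).+1 y X]) (h y - h X) =
    \sum_(e \in [set e : plane R * plane R | adj k q (size w).+1 e.1 e.2 /\ e.2 = X])
      (h e.1 - h X).
  rewrite (_ : [set e | _] = (fun y => (y, X)) @` [set y | adj k q (size w).+1 y X]).
    by rewrite fsbig_image // => x y _ _ [].
  apply/seteqP; split => [[y z] /= [h1 h2]|_ [y h1 <-] //].
  by exists y; rewrite /= -?h2.
rewrite (sum_adj hk hq (size w).+1 (fun e => e.2 = X) (fun e => h e.1 - h X)).
rewrite -addn1 sum_words_cat (bigD1_seq w) /=; [|by rewrite mem_words|exact: words_uniq].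
rewrite [X in _ + X]big_seq_cond [X in _ + X]big1 ?addr0; last first.
  move=> u' /andP [+ uw]; rewrite mem_words => /eqP hs.
  rewrite (@sum_wordsS _ _ 0); apply: big1 => a _; rewrite big_seq1.
  apply: big1 => l _; apply: big1 => m _; case: asboolP => //; rewrite word_map_cat => e.
  move/eqP: uw; case; apply/esym.
  apply: (cell_unique hk c_cell c_sum (esym hs) p_simplex _ p_novertex (esym e)).
  by move=> l' /=; rewrite c_cell c_q mulr_ge0 ?invr_ge0 ?addr_ge0.
rewrite (@sum_wordsS _ _ 0) => hsum.
apply/eqP; rewrite -oppr_eq0 -sum_flux_vertex //; apply/eqP.
rewrite -[RHS]oppr0 -[in RHS]hsum -sumrN; apply: eq_bigr => a _.
rewrite big_seq1 -sumrN.
transitivity (\sum_l \sum_m (if cell_map q a (q l) == p then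
   h (word_map q w (cell_map q a (q l))) - h (word_map q w (cell_map q a (q m))) else 0)).
  apply: eq_bigr => l _; case: ifP => e; first by [].
  by rewrite big1.
rewrite exchange_big /=; apply: eq_bigr => l _.
rewrite (bigD1 l) //= subrr if_same add0r -sumrN.
apply: eq_big => [m|m ml]; first by rewrite eq_sym.
rewrite !word_map_cat /=.
have -> : `[< word_map q w (cell_map q a (q m)) = X >] = (cell_map q a (q m) == p).
  apply/asboolP/eqP => [|-> //]; exact: (word_map_inj hk).
by case: eqP => [->|]; rewrite ?oppr0 // opprB.
Qed.

End Harmonicity.

Lemma grid_harmonic_swap (R : realFieldType) k (U : nat -> nat -> R) :
  grid_harmonic k U -> grid_harmonic k (fun i j => U j i).
Proof.
move=> h i j nc; have nc' : noncorner k j i by move: nc; rewrite /noncorner; lia.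
have := h j i nc'; rewrite /grid_laplacian addnC.
by do 3 case: ifP => _; lra.
Qed.

Lemma grid_harmonic_refl (R : realFieldType) k (U : nat -> nat -> R) :
  grid_harmonic k U -> grid_harmonic k (fun i j => U i (k - i - j)%N).
Proof.
move=> h i j nc; have hij : (i + j <= k)%N by case/and4P: nc.
have nc' : noncorner k i (k - i - j) by move: nc; rewrite /noncorner; lia.
have := h i _ nc'; rewrite /grid_laplacian.
have -> : (i + (k - i - j) < k)%N = (0 < j)%N by lia.
have -> : (0 < k - i - j)%N = (i + j < k)%N by lia.
have e1 : (k - i.+1 - j = (k - i - j).-1)%N by lia.
have e2 : (k - i - j.+1 = (k - i - j).-1)%N by lia.
rewrite e1 e2.
have e3 : (0 < i)%N -> (k - i.-1 - j = (k - i - j).+1)%N by lia.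
have e4 : (0 < i)%N -> (k - i.-1 - j.+1 = k - i - j)%N by lia.
have e5 : (0 < j)%N -> (k - i - j.-1 = (k - i - j).+1)%N by lia.
have e6 : (0 < j)%N -> (k - i.+1 - j.-1 = k - i - j)%N by lia.
case: ifP => c1; case: ifP => c2; case: ifP => c3;
  rewrite ?(e3 c2) ?(e4 c2) ?(e5 c1) ?(e6 c1) ?(e5 c3) ?(e6 c3); lra.
Qed.

(** * Harmonic extension *)

Section FormLemmas.
Variable R : realFieldType.
Implicit Types x y z : 'I_3 -> R.

Lemma tri_formC x y : tri_form x y = tri_form y x.
Proof. by rewrite !tri_formE; ring. Qed.

Lemma tri_form_lin s t x y z :
  tri_form (fun i => s * x i + t * y i) z = s * tri_form x z + t * tri_form y z.
Proof. by rewrite !tri_formE; ring. Qed.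

Lemma tri_form_sqr x y :
  tri_form (fun i => 1 * x i + 1 * y i) (fun i => 1 * x i + 1 * y i) =
  tri_form x x + 2 * tri_form x y + tri_form y y.
Proof. by rewrite !tri_formE; ring. Qed.

Lemma tri_form_parallelogram x y :
  tri_form x x <= 2 * tri_form y y +
    2 * tri_form (fun i => 1 * x i + (-1) * y i) (fun i => 1 * x i + (-1) * y i).
Proof.
rewrite -subr_ge0 [X in 0 <= X](_ : _ =
  tri_form (fun i => 1 * x i + (-2) * y i) (fun i => 1 * x i + (-2) * y i)).
  exact: tri_form_ge0.
by rewrite !tri_formE; ring.
Qed.

Lemma tri_form_add_cst s x y : tri_form (fun i => s + x i) (fun i => s + y i) = tri_form x y.
Proof. by rewrite !tri_formE; ring. Qed.

(* Here [al] and [be] are the values at the two other vertices of the corner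
   cell at [i] of the harmonic function equal to 1 at [j] and 0 at [i], [l]. *)
Lemma corner_form_bound (al be rho : R) (i j l : 'I_3) x y x' y' :
  i != j -> i != l -> j != l -> 0 < al -> 0 < be -> al + be < 1 -> 1 <= rho ->
  x' i = x i -> x' j = x i + al * (x j - x i) + be * (x l - x i) ->
  x' l = x i + be * (x j - x i) + al * (x l - x i) ->
  y' i = y i -> y' j = y i + al * (y j - y i) + be * (y l - y i) ->
  y' l = y i + be * (y j - y i) + al * (y l - y i) ->
  `|flux i x * flux i y| <= (2 * (al * be))^-1 * (`|tri_form x y| + `|rho * tri_form x' y'|).
Proof.
move=> ij il jl a0 b0 ab r1.
have l1 : (al - be) ^+ 2 <= 1.
  have -> : (al - be) ^+ 2 = (al + be) ^+ 2 - 4 * (al * be) by ring.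
  have : 0 < al * be by exact: mulr_gt0.
  have : (al + be) ^+ 2 <= 1 by rewrite expr_le1 ?addr_ge0 // ltW.
  lra.
move=> xi xj xl yi yj yl.
have tE u v : tri_form u v = (u i - u j) * (v i - v j) + (u i - u l) * (v i - v l) +
    (u j - u l) * (v j - v l).
  rewrite tri_formE; clear -ij il jl; move: ij il jl.
  by elim/ord3P: i; elim/ord3P: j; elim/ord3P: l => //= _ _ _; ring.
have fE u : flux i u = (u i - u j) + (u i - u l).
  rewrite /flux sum3; clear -ij il jl; move: ij il jl.
  by elim/ord3P: i; elim/ord3P: j; elim/ord3P: l => //= _ _ _; ring.
(* On the differences from the vertex i the restriction has eigenvalue [al + be] on the symmetric
   part, which is the flux, and [al - be] on the antisymmetric part. Subtracting [(al - be) ^+ 2]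
   times the form cancels the latter. *)
have key : 2 * (al * be) * (flux i x * flux i y) =
    tri_form x' y' - (al - be) ^+ 2 * tri_form x y.
  have d (a b c' u v w : R) : u = a -> v = a + al * (b - a) + be * (c' - a) ->
      w = a + be * (b - a) + al * (c' - a) ->
      [/\ u - v = al * (a - b) + be * (a - c'), u - w = be * (a - b) + al * (a - c') &
          v - w = (al - be) * ((a - c') - (a - b))].
    by move=> -> -> ->; split; ring.
  have [e1 e2 e3] := d _ _ _ _ _ _ xi xj xl; have [g1 g2 g3] := d _ _ _ _ _ _ yi yj yl.
  rewrite !tE !fE e1 e2 e3 g1 g2 g3.
  have sx : x j - x l = (x i - x l) - (x i - x j) by ring.
  have sy : y j - y l = (y i - y l) - (y i - y j) by ring.
  rewrite sx sy.
  move: (x i - x j) (x i - x l) (y i - y j) (y i - y l) => p s p' s'.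
  ring.
have p0 : 0 < 2 * (al * be) by rewrite !mulr_gt0.
rewrite ler_pdivlMl //.
have -> : 2 * (al * be) * `|flux i x * flux i y| = `|2 * (al * be) * (flux i x * flux i y)|.
  by rewrite [RHS]normrM (gtr0_norm p0).
rewrite key; apply: le_trans (ler_normB _ _) _; rewrite addrC; apply: lerD.
  by rewrite (normrM (_ ^+ 2)) ger0_norm ?sqr_ge0 // -[leRHS]mul1r ler_wpM2r.
rewrite (normrM rho) ger0_norm; last by lra.
by rewrite -[leLHS]mul1r ler_wpM2r.
Qed.

(** Cayley-Hamilton for the matrix M of the form Q: |M v|^2 = tr(M) Q(v) - det(M) |v|^2, hence the
    constant det(M) / tr(M). *)
Lemma pos_def_bound (a b d : R) :
  (forall s t, a * s ^+ 2 + 2 * b * s * t + d * t ^+ 2 = 0 -> s = 0 /\ t = 0) ->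
  (forall s t, 0 <= a * s ^+ 2 + 2 * b * s * t + d * t ^+ 2) ->
  exists2 c, 0 < c & forall s t,
    c * (s ^+ 2 + t ^+ 2) <= a * s ^+ 2 + 2 * b * s * t + d * t ^+ 2.
Proof.
move=> hdef hpos.
have a0 : 0 < a.
  rewrite lt_def; apply/andP; split; last by have := hpos 1 0; lra.
  by apply/eqP => h; have [] := hdef 1 0 ltac:(rewrite h; ring); lra.
have d0 : 0 <= d by have := hpos 0 1; lra.
have D : 0 < a * d - b ^+ 2.
  rewrite -(pmulr_rgt0 _ a0).
  have e : a * (a * d - b ^+ 2) = a * (- b) ^+ 2 + 2 * b * (- b) * a + d * a ^+ 2 by ring.
  rewrite lt_def; apply/andP; split; last by rewrite e.
  by apply/eqP; rewrite e => /hdef []; lra.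
exists ((a * d - b ^+ 2) / (a + d)); first by rewrite divr_gt0 //; lra.
move=> s t; rewrite mulrAC ler_pdivrMr; last by lra.
rewrite -subr_ge0.
have -> : (a * s ^+ 2 + 2 * b * s * t + d * t ^+ 2) * (a + d) -
    (a * d - b ^+ 2) * (s ^+ 2 + t ^+ 2) =
    (a * s + b * t) ^+ 2 + (b * s + d * t) ^+ 2 by ring.
by rewrite addr_ge0 ?sqr_ge0.
Qed.

End FormLemmas.

Section Extension.
Variables (R : realType) (k : nat) (q : 'I_3 -> plane R) (r : R).
Hypothesis hk : (2 <= k)%N.
Hypothesis hq : equilateral q.
Hypothesis hr : is_renormalization_constant k q r.
Implicit Types (u v : plane R -> R) (x y : 'I_3 -> R).

Let r_gt0 : 0 < r. Proof. by case: hr => /andP []. Qed.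
Let r_neq0 : r != 0. Proof. by rewrite gt_eqF. Qed.

Definition level1_form u v : R :=
  \sum_(a : cell_index k) tri_form (cell_values q u [:: a]) (cell_values q v [:: a]).

Lemma energy1E u v : energy k q r 1 u v = r^-1 * level1_form u v.
Proof.
rewrite /energy expr1 edge_sumE // (@sum_wordsS _ _ 0); congr (_ * _).
by apply: eq_bigr => a _; rewrite big_seq1.
Qed.

Lemma energy0E u v : energy k q r 0 u v = tri_form (u \o q) (v \o q).
Proof. by rewrite /energy expr0 invr1 mul1r edge_sumE // big_seq1. Qed.

Lemma level1_formC u v : level1_form u v = level1_form v u.
Proof. by apply: eq_bigr => a _; rewrite tri_formC. Qed.

Lemma level1_form_lin s t u v f :
  level1_form (fun p => s * u p + t * v p) f = s * level1_form u f + t * level1_form v f.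
Proof.
rewrite /level1_form !mulr_sumr -big_split; apply: eq_bigr => a _ /=.
exact: tri_form_lin.
Qed.

Lemma level1_form_linr s t u v f :
  level1_form f (fun p => s * u p + t * v p) = s * level1_form f u + t * level1_form f v.
Proof. by rewrite level1_formC level1_form_lin !(level1_formC f). Qed.

Lemma level1_form_sqr u v :
  level1_form (fun p => 1 * u p + 1 * v p) (fun p => 1 * u p + 1 * v p) =
  level1_form u u + 2 * level1_form u v + level1_form v v.
Proof. by rewrite level1_form_lin !level1_form_linr (level1_formC v u); ring. Qed.

Lemma level1_form_ge0 u : 0 <= level1_form u u.
Proof. by apply: sumr_ge0 => a _; exact: tri_form_ge0. Qed.

Lemma level1_min u : exists2 u1, (forall l, u1 (q l) = u (q l)) &
  level1_form u1 u1 = r * tri_form (u \o q) (u \o q).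
Proof.
have [[u1 h1 h2] _] := hr.2 u; exists u1.
  by move=> l; apply: h1; rewrite inE; exists l.
by rewrite -energy0E -h2 energy1E mulVKf.
Qed.

Lemma level1_ge u u1 : (forall l, u1 (q l) = u (q l)) ->
  r * tri_form (u \o q) (u \o q) <= level1_form u1 u1.
Proof.
move=> h; have [_ h2] := hr.2 u; rewrite -energy0E.
rewrite -ler_pdivlMl // -energy1E; apply: h2 => p; rewrite inE => -[l _ <-]; exact: h.
Qed.

Lemma minimizer_exists u : exists2 u1, (forall l, u1 (q l) = u (q l)) &
  forall v, (forall l, v (q l) = 0) -> level1_form u1 v = 0.
Proof.
have [u1 h1 h2] := level1_min u; exists u1 => // v hv.
set b := level1_form u1 v; pose d := level1_form v v.
have d0 : 0 <= d := level1_form_ge0 v.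
have hmin t : 0 <= 2 * t * b + t ^+ 2 * d.
  have hb l : (fun p => 1 * u1 p + t * v p) (q l) = u (q l).
    by rewrite /= h1 hv mulr0 addr0 mul1r.
  have := @level1_ge u (fun p => 1 * u1 p + t * v p) hb.
  rewrite -h2 level1_form_lin !level1_form_linr (level1_formC v u1) -/b -/d.
  lra.
have d1 : d + 1 != 0 by rewrite gt_eqF //; lra.
(* This value of t makes the variation negative unless [b] is 0; the added 1 avoids a division by
   0. *)
have := hmin (- b / (d + 1)).
have -> : 2 * (- b / (d + 1)) * b + (- b / (d + 1)) ^+ 2 * d =
    - (b ^+ 2 * ((d + 2) / (d + 1) ^+ 2)) by field.
rewrite oppr_ge0 => h.
have p : 0 < (d + 2) / (d + 1) ^+ 2 by rewrite divr_gt0 ?exprn_gt0 //; lra.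
by apply/eqP; rewrite -sqrf_eq0 eq_le sqr_ge0 andbT -(pmulr_lle0 _ p).
Qed.

Theorem harmonic_extension : exists H : ('I_3 -> R) -> plane R -> R,
  [/\ forall x l, H x (q l) = x l,
      forall x y s t p, H (fun i => s * x i + t * y i) p = s * H x p + t * H y p,
      forall x v, level1_form (H x) v = r * tri_form x (v \o q) &
      forall x, grid_harmonic k (grid_values k q (H x))].
Proof.
have qI l l' : q l = q l' -> l = l'.
  have [c [_ _ c_q _]] := barycentric_coordinates hk hq.
  move=> e; apply/eqP; have := c_q l l'; rewrite -e c_q eqxx.
  by case: eqP => // _ /eqP; rewrite oner_eq0.
have hx0 l : exists u1 : plane R -> R, (forall m, u1 (q m) = (m == l)%:R) /\
    forall v, (forall l, v (q l) = 0) -> level1_form u1 v = 0.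
  have [u1 e1 e2] := minimizer_exists (fun p => (p == q l)%:R); exists u1; split => //.
  by move=> m; rewrite e1 (inj_eq (qI : injective q)).
have [hx hxP] := choice hx0.
(* Combining minimizers for the three indicator functions makes [H] linear by construction; that
   [H x] is itself a minimizer is shown in [HH]. *)
pose H x p := x o0 * hx o0 p + x o1 * hx o1 p + x o2 * hx o2 p.
have Hq x l : H x (q l) = x l.
  rewrite /H !(hxP _).1; elim/ord3P: l => /=; rewrite ?eqxx /=; ring.
have Hlin x y s t p : H (fun i => s * x i + t * y i) p = s * H x p + t * H y p.
  by rewrite /H; ring.
have Hweak x v : (forall l, v (q l) = 0) -> level1_form (H x) v = 0.
  move=> hv; rewrite (_ : H x = fun p => 1 * (x o0 * hx o0 p + x o1 * hx o1 p) + x o2 * hx o2 p).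
    rewrite !level1_form_lin ((hxP o0).2 _ hv) ((hxP o1).2 _ hv) ((hxP o2).2 _ hv); ring.
  by apply/funext => p; rewrite /H mul1r.
have HH x : level1_form (H x) (H x) = r * tri_form x x.
  have e : H x \o q = x by apply/funext => l; rewrite /= Hq.
  apply: le_anti; apply/andP; split; last first.
    by have := @level1_ge (H x) (H x) (fun=> erefl); rewrite e.
  have [u1 h1 h2] := level1_min (H x); rewrite e in h2; rewrite -h2.
  pose d p := 1 * u1 p + (-1) * H x p.
  have -> : u1 = fun p => 1 * H x p + 1 * d p by apply/funext => p; rewrite /d; ring.
  rewrite level1_form_sqr (Hweak x d).
    by have := level1_form_ge0 d; lra.
  by move=> l; rewrite /d h1; ring.
have HHp x y : level1_form (H x) (H y) = r * tri_form x y.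
  have := HH (fun i => 1 * x i + 1 * y i).
  have -> : H (fun i => 1 * x i + 1 * y i) = fun p => 1 * H x p + 1 * H y p.
    by apply/funext => p; rewrite Hlin.
  rewrite level1_form_sqr !HH tri_form_sqr; lra.
exists H; split => //.
  move=> x v.
  (* The extension of the corner values of [v] is handled by polarization; the remainder vanishes at
     the corners and is orthogonal to [H x]. *)
  have -> : v = fun p => 1 * H (v \o q) p + 1 * (1 * v p + (-1) * H (v \o q) p).
    by apply/funext => p; ring.
  rewrite level1_form_linr HHp (Hweak x (fun p => _)); last by move=> l; rewrite Hq /=; ring.
  rewrite mulr0 addr0 mul1r; congr (_ * tri_form _ _); apply/funext => l /=.
  by rewrite Hq /=; ring.
by move=> x; apply: weak_grid_harmonic => // v; exact: Hweak.
Qed.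

End Extension.

(** * Restriction of harmonic functions to cells *)

Section Restriction.
Variables (R : realType) (k : nat) (q : 'I_3 -> plane R).
Hypothesis hk : (2 <= k)%N.
Hypothesis hq : equilateral q.
Variable H : ('I_3 -> R) -> plane R -> R.
Hypothesis H_vertex : forall x l, H x (q l) = x l.
Hypothesis H_lin : forall x y s t p,
  H (fun i => s * x i + t * y i) p = s * H x p + t * H y p.
Hypothesis H_harm : forall x, grid_harmonic k (grid_values k q (H x)).
Implicit Types (u v : plane R -> R) (x y : 'I_3 -> R) (a : cell_index k).

Definition restr a x : 'I_3 -> R := cell_values q (H x) [:: a].

Lemma restr_lin a x y s t :
  restr a (fun i => s * x i + t * y i) = fun i => s * restr a x i + t * restr a y i.
Proof. by apply/funext => i; exact: H_lin. Qed.

Lemma cell_values_grid u a l : cell_values q u [:: a] l =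
  grid_values k q u (val a o0 + (l == o0)) (val a o1 + (l == o1)).
Proof. by rewrite /cell_values /= cell_map_vertex. Qed.

Lemma grid_harmonic_eq u x : grid_harmonic k (grid_values k q u) ->
  (forall l, u (q l) = x l) -> forall i j, (i + j <= k)%N ->
  grid_values k q u i j = grid_values k q (H x) i j.
Proof.
move=> hu hx; apply: grid_unique => //.
- by rewrite /grid_values grid_point_q0 // hx H_vertex.
- by rewrite /grid_values grid_point_q1 // hx H_vertex.
- by rewrite /grid_values grid_point_q2 // hx H_vertex.
Qed.

Lemma restr_harmonic u a : grid_harmonic k (grid_values k q u) ->
  cell_values q u [:: a] = restr a (u \o q).
Proof.
move=> hu; apply/funext => l; rewrite /restr !cell_values_grid.
apply: (grid_harmonic_eq hu (x := u \o q)) => //.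
by have := cell_sum3 a => /= h; elim/ord3P: l => /=; lia.
Qed.

Lemma restr_cst s a : restr a (fun=> s) = fun=> s.
Proof.
have := @restr_harmonic (fun=> s) a; rewrite /comp => <- // i j _.
by rewrite /grid_laplacian /grid_values !subrr !addr0 !if_same !addr0.
Qed.

Lemma restr_nondegenerate a x : tri_form (restr a x) (restr a x) = 0 ->
  forall i j, x i = x j.
Proof.
move=> /tri_form_eq0 h; pose U := grid_values k q (H x).
have ha : (val a o0 + val a o1 < k)%N by have := cell_sum3 a => /=; lia.
have [e0 e1] : U k 0%N = U 0%N 0%N /\ U 0%N k = U 0%N 0%N.
  apply: (grid_nondegenerate hk (@H_harm x) ha); split.
    by have := h o0 o2; rewrite /restr !cell_values_grid /= !addn0 addn1.
  by have := h o1 o2; rewrite /restr !cell_values_grid /= !addn0 addn1.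
rewrite /U /grid_values grid_point_q0 // grid_point_q2 // !H_vertex in e0.
rewrite /U /grid_values grid_point_q1 // grid_point_q2 // !H_vertex in e1.
by do 2 apply: ord3P; rewrite ?e0 ?e1.
Qed.

(** Modulo constants, a function is the pair (s, t) of its increments from the vertex 0. By
    [restr_nondegenerate] the energy of the restriction is positive definite in (s, t); the factor 3
    comes from s^2 + t^2 + (s - t)^2 <= 3 (s^2 + t^2). *)
Lemma restr_lower_bound_cell a : exists2 c, 0 < c &
  forall x, c * tri_form x x <= tri_form (restr a x) (restr a x).
Proof.
pose y (s t : R) (i : 'I_3) := s * (i == o1)%:R + t * (i == o2)%:R.
pose e1 (i : 'I_3) : R := (i == o1)%:R; pose e2 (i : 'I_3) : R := (i == o2)%:R.
have yE s t : tri_form (restr a (y s t)) (restr a (y s t)) =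
    tri_form (restr a e1) (restr a e1) * s ^+ 2 +
    2 * tri_form (restr a e1) (restr a e2) * s * t +
    tri_form (restr a e2) (restr a e2) * t ^+ 2.
  have -> : restr a (y s t) = fun i => s * restr a e1 i + t * restr a e2 i.
    by rewrite -restr_lin.
  by rewrite !tri_formE; ring.
have [||c c0 hc] := @pos_def_bound R (tri_form (restr a e1) (restr a e1))
  (tri_form (restr a e1) (restr a e2)) (tri_form (restr a e2) (restr a e2)).
- move=> s t; rewrite -yE => /restr_nondegenerate h.
  have := h o1 o0; have := h o2 o0; rewrite /y /= !mulr0 !mulr1 !addr0 add0r.
  by move=> -> ->.
- by move=> s t; rewrite -yE; exact: tri_form_ge0.
exists (c / 3); first by rewrite divr_gt0.
move=> x; pose s := x o1 - x o0; pose t := x o2 - x o0.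
have xE : x = fun i => 1 * x o0 + 1 * y s t i.
  apply/funext; apply: ord3P; rewrite /y /= /s /t; ring.
have -> : restr a x = fun i => x o0 + restr a (y s t) i.
  rewrite {1}xE (restr_lin a (fun=> x o0)) restr_cst.
  by apply/funext => i; rewrite !mul1r.
rewrite tri_form_add_cst yE; apply: le_trans (hc s t).
rewrite -mulrA ler_pM2l // ler_pdivrMl // tri_formE -/s.
have -> : x o0 - x o1 = - s by rewrite /s opprB.
have -> : x o0 - x o2 = - t by rewrite /t opprB.
have -> : x o1 - x o2 = s - t by rewrite /s /t; ring.
by have := sqr_ge0 (s + t); have := sqr_ge0 s; have := sqr_ge0 t; lra.
Qed.

Variable r : R.
Hypothesis r01 : 0 < r < 1.
Hypothesis H_form : forall x v, level1_form k q (H x) v = r * tri_form x (v \o q).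

Lemma restr_pairing x v : \sum_a r^-1 * tri_form (restr a x) (cell_values q v [:: a]) =
  tri_form x (v \o q).
Proof.
have r0 : r != 0 by case/andP: r01 => h _; rewrite gt_eqF.
by rewrite -mulr_sumr -[X in _ * X]/(level1_form k q (H x) v) H_form mulKf.
Qed.

Lemma restr_split x y : tri_form x y = \sum_a r^-1 * tri_form (restr a x) (restr a y).
Proof.
rewrite restr_pairing; congr tri_form; apply/funext => l /=.
by rewrite H_vertex.
Qed.

Lemma restr_lower_bound : exists2 c, 0 < c &
  forall a x, c * tri_form x x <= r^-1 * tri_form (restr a x) (restr a x).
Proof.
have [c c_gt0 c_le] := fin_all_exists2 restr_lower_bound_cell.
have [r0 r1] := andP r01.
exists (1 + \sum_a (c a)^-1)^-1.
  rewrite invr_gt0 ltr_pwDl // sumr_ge0 // => a _; rewrite invr_ge0 ltW //.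
move=> a x; apply: (@le_trans _ _ (tri_form (restr a x) (restr a x))); last first.
  by rewrite ler_peMl ?tri_form_ge0 // invf_ge1 // ltW.
apply: le_trans (c_le a x); rewrite ler_wpM2r ?tri_form_ge0 //.
rewrite invf_ple ?posrE //; last first.
  by rewrite ltr_pwDl // sumr_ge0 // => b _; rewrite invr_ge0 ltW.
rewrite (bigD1 a) //= addrCA lerDl addr_ge0 // sumr_ge0 // => b _.
by rewrite invr_ge0 ltW.
Qed.

Definition corner_x (i : 'I_3) n : nat := if i == o0 then n else 0%N.
Definition corner_y (i : 'I_3) n : nat := if i == o1 then n else 0%N.
Definition corner_cell i : cell_index k := cell_at hk (corner_x i k.-1) (corner_y i k.-1).

Lemma grid_point_corner i : grid_point k q (corner_x i k) (corner_y i k) = q i.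
Proof.
by elim/ord3P: i; rewrite /corner_x /corner_y /= ?grid_point_q0 ?grid_point_q1 ?grid_point_q2.
Qed.

Lemma restr_corner_grid i x l : restr (corner_cell i) x l =
  grid_values k q (H x) (corner_x i k.-1 + (l == o0)) (corner_y i k.-1 + (l == o1)).
Proof.
rewrite /restr cell_values_grid /corner_cell cell_at0 ?cell_at1 //;
  by elim/ord3P: i; rewrite /corner_x /corner_y /=; lia.
Qed.

Lemma restr_corner_vertex i x : restr (corner_cell i) x i = x i.
Proof.
rewrite restr_corner_grid /grid_values -(H_vertex x i) -(grid_point_corner i).
by congr (H _ (grid_point _ _ _ _)); elim/ord3P: i; rewrite /corner_x /corner_y /=; lia.
Qed.

(** Pair with the indicator function of [q i]: only the corner cell contains that vertex. *)
Lemma restr_corner_flux i x : flux i (restr (corner_cell i) x) = r * flux i x.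
Proof.
have r0 : r != 0 by case/andP: r01 => h _; rewrite gt_eqF.
have qI l l' : q l = q l' -> l = l'.
  have [c [_ _ c_q _]] := barycentric_coordinates hk hq.
  move=> e; apply/eqP; have := c_q l l'; rewrite -e c_q eqxx.
  by case: eqP => // _ /eqP; rewrite oner_eq0.
pose v (p : plane R) : R := (p == q i)%:R.
have := restr_pairing x v; rewrite -mulr_sumr flux_pairing (bigD1 i) //=.
rewrite [X in _ = _ + X]big1 ?addr0; last first.
  by move=> l li; rewrite /v (inj_eq (qI : injective q)) (negbTE li) mul0r.
rewrite /v eqxx mul1r => <-; rewrite mulVKf //.
have hi : (corner_x i k + corner_y i k <= k)%N.
  by elim/ord3P: i {v}; rewrite /corner_x /corner_y /=; lia.
transitivity (\sum_a \sum_l (if cell_map q a (q l) == grid_point k q (corner_x i k) (corner_y i k)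
    then flux l (restr a x) else 0)); last first.
  rewrite grid_point_corner; apply: eq_bigr => a _; rewrite flux_pairing.
  by apply: eq_bigr => l _; rewrite /cell_values /=; case: ifP; rewrite ?mul1r ?mul0r.
rewrite (sum_at_vertex hk hq (fun a l => flux l (restr a x)) hi) /corner_cell.
have kk : (0 < k)%N by lia.
by elim/ord3P: i {v hi}; rewrite /corner_x /corner_y /= ?addn0 ?add0n ?ltnn ?kk ?addr0 ?add0r.
Qed.

Lemma grid_values_perm (s : 'I_3 -> 'I_3) (f g : nat -> nat -> nat) x :
  grid_harmonic k (fun i j => grid_values k q (H x) (f i j) (g i j)) ->
  (forall l, (f (corner_x l k) (corner_y l k) = corner_x (s l) k)%N) ->
  (forall l, (g (corner_x l k) (corner_y l k) = corner_y (s l) k)%N) ->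
  forall i j, (i + j <= k)%N -> grid_values k q (H (x \o s)) i j =
    grid_values k q (H x) (f i j) (g i j).
Proof.
move=> hh hf hg.
have e l : grid_values k q (H (x \o s)) (corner_x l k) (corner_y l k) =
    grid_values k q (H x) (f (corner_x l k) (corner_y l k)) (g (corner_x l k) (corner_y l k)).
  by rewrite hf hg /grid_values !grid_point_corner !H_vertex.
by apply: grid_unique => //; [exact: (e o0) | exact: (e o1) | exact: (e o2)].
Qed.

Definition swap3 (i : 'I_3) : 'I_3 -> 'I_3 := fun l =>
  if i == o0 then (if l == o1 then o2 else if l == o2 then o1 else l)
  else if i == o1 then (if l == o0 then o2 else if l == o2 then o0 else l)
  else (if l == o0 then o1 else if l == o1 then o0 else l).

(* The gasket is symmetric under the reflection fixing the corner i. *)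
Lemma restr_corner_swap i x l :
  restr (corner_cell i) (x \o swap3 i) l = restr (corner_cell i) x (swap3 i l).
Proof.
rewrite !restr_corner_grid.
have hl : (corner_x i k.-1 + (l == o0) + (corner_y i k.-1 + (l == o1)) <= k)%N.
  by elim/ord3P: i; elim/ord3P: l; rewrite /corner_x /corner_y /=; lia.
have h1 := grid_harmonic_refl (@H_harm x).
have h2 := grid_harmonic_swap (@H_harm x).
have h3 := grid_harmonic_swap (grid_harmonic_refl h2).
elim/ord3P: i hl => hl.
- rewrite (grid_values_perm (f := fun i _ => i) (g := fun i j => (k - i - j)%N)) //;
    try by (elim/ord3P; rewrite /corner_x /corner_y /swap3 /=; lia).
  by congr grid_values; elim/ord3P: l {hl}; rewrite /corner_x /corner_y /swap3 /=; lia.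
- rewrite (grid_values_perm (f := fun i j => (k - j - i)%N) (g := fun i j => j)) //;
    try by (elim/ord3P; rewrite /corner_x /corner_y /swap3 /=; lia).
  by congr grid_values; elim/ord3P: l {hl}; rewrite /corner_x /corner_y /swap3 /=; lia.
rewrite (grid_values_perm (f := fun i j => j) (g := fun i j => i)) //;
  try by (elim/ord3P; rewrite /corner_x /corner_y /swap3 /=; lia).
by congr grid_values; elim/ord3P: l {hl}; rewrite /corner_x /corner_y /swap3 /=; lia.
Qed.

Lemma restr_corner_gt0 i j l : i != j -> i != l ->
  0 < restr (corner_cell i) (fun m => (m == j)%:R) l.
Proof.
move=> ij il; rewrite restr_corner_grid; apply: (grid_gt0 hk) => //.
- by rewrite /grid_values grid_point_q0 // H_vertex.
- by rewrite /grid_values grid_point_q1 // H_vertex.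
- by rewrite /grid_values grid_point_q2 // H_vertex.
- rewrite /grid_values grid_point_q0 // grid_point_q1 // grid_point_q2 // !H_vertex.
  by elim/ord3P: j {ij}; rewrite /= ?addr0 ?add0r ltr01.
by elim/ord3P: i ij il; elim/ord3P: l => //= _ _; rewrite /corner_x /corner_y /noncorner /=; lia.
Qed.

Lemma restr_corner_bound_at i : exists2 C, 0 < C & forall x y,
  `|flux i x * flux i y| <= C * (`|tri_form x y| +
     `|r^-1 * tri_form (restr (corner_cell i) x) (restr (corner_cell i) y)|).
Proof.
have [r0 r1] := andP r01.
have [j [l [ij il jl sj sl]]] : exists j l, [/\ i != j, i != l, j != l,
    swap3 i j = l & swap3 i l = j].
  by elim/ord3P: i; [exists o1, o2 | exists o0, o2 | exists o0, o1].
pose A := restr (corner_cell i).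
pose e j (m : 'I_3) : R := (m == j)%:R.
pose al := A (e j) j; pose be := A (e j) l.
have al0 : 0 < al by exact: restr_corner_gt0.
have be0 : 0 < be by exact: restr_corner_gt0.
have es : e l = e j \o swap3 i.
  apply/funext => m; rewrite /e /=; congr (_%:R).
  move: ij il jl sj sl; elim/ord3P: i {A al be al0 be0}; elim/ord3P: j; elim/ord3P: l => //= _ _ _;
    by elim/ord3P: m.
have Alj : A (e l) j = be by rewrite es /A restr_corner_swap sj.
have All : A (e l) l = al by rewrite es /A restr_corner_swap sl.
have Aei m : i != m -> A (e m) i = 0.
  by move=> im; rewrite /A restr_corner_vertex /e (negbTE im).
have fE x : flux i x = (x i - x j) + (x i - x l).
  rewrite /flux sum3; clear -ij il jl; move: ij il jl.
  by elim/ord3P: i; elim/ord3P: j; elim/ord3P: l => //= _ _ _; ring.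
(* The function [e j] has flux - 1 at i and its restriction has flux [- (al + be)], so [al + be] is
   in fact [r]. *)
have ab : al + be < 1.
  have := restr_corner_flux i (e j); rewrite -/A !fE Aei // -/al -/be.
  rewrite /e eqxx (negbTE ij) (eq_sym l) (negbTE jl) /=; lra.
have xE x : x = fun m => 1 * x i + 1 * ((x j - x i) * e j m + (x l - x i) * e l m).
  apply/funext => m; rewrite /e; clear -ij il jl; move: ij il jl.
  elim/ord3P: i; elim/ord3P: j; elim/ord3P: l => //= _ _ _; elim/ord3P: m => /=; ring.
have AE x m : A x m = x i + (x j - x i) * A (e j) m + (x l - x i) * A (e l) m.
  rewrite {1}(xE x) /A (restr_lin _ (fun=> x i)) restr_cst restr_lin; ring.
exists (2 * (al * be))^-1; first by rewrite invr_gt0 !mulr_gt0.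
move=> x y; apply: (corner_form_bound ij il jl al0 be0 ab).
- by rewrite invf_ge1 // ltW.
- exact: restr_corner_vertex.
- by rewrite -/A AE Alj -/al; ring.
- by rewrite -/A AE All -/be; ring.
- exact: restr_corner_vertex.
- by rewrite -/A AE Alj -/al; ring.
- by rewrite -/A AE All -/be; ring.
Qed.

Lemma restr_corner_bound : exists2 C, 1 <= C & forall i x y,
  `|flux i x * flux i y| <= C * (`|tri_form x y| +
     `|r^-1 * tri_form (restr (corner_cell i) x) (restr (corner_cell i) y)|).
Proof.
have [C C0 hC] := fin_all_exists2 restr_corner_bound_at.
exists (1 + \sum_i C i).
  by rewrite lerDl sumr_ge0 // => i _; rewrite ltW.
move=> i x y; apply: le_trans (hC i x y) _; rewrite ler_wpM2r ?addr_ge0 //.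
rewrite (bigD1 i) //= addrCA lerDl addr_ge0 // sumr_ge0 // => j _; exact: ltW.
Qed.

(** As [eps] depends neither on the functions nor on the depth, it serves all cells of a level at
    once. *)
Theorem restr_abs_continuous beta : 0 < beta -> exists2 eps, 0 < eps &
  forall N x y S, 0 < tri_form x x ->
    mass restr r^-1 (fun x => tri_form x x) N x S <= eps * tri_form x x ->
    mass restr r^-1 (fun x => tri_form x x) N y S <= beta * tri_form y y.
Proof.
have ri : 0 < r^-1 by rewrite invr_gt0; case/andP: r01.
have [C C1 hC] := restr_corner_bound; have [c c0 hc] := restr_lower_bound.
have [d01 g01 hd] := mass_dichotomy ri C1 restr_split hC.
move=> b0.
exact: (mass_abs_continuous ri (@tri_form_ge0 R) (fun x => restr_split x x) c0 hc d01 g01 hd b0).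
Qed.

End Restriction.

(** * Approximation of Borel sets by unions of cells *)

Section FiniteMeasure.
Context d (X : measurableType d) (R : realType).
Variable mu : {measure set X -> \bar R}.
Hypothesis mu_fin : (mu setT < +oo)%E.
Implicit Types A B : set X.

Definition rmeas A : R := fine (mu A).

Lemma rmeasE A : measurable A -> mu A = (rmeas A)%:E.
Proof.
move=> mA; rewrite fineK // ge0_fin_numE // (le_lt_trans _ mu_fin) //.
by rewrite le_measure ?inE.
Qed.

Lemma rmeas_ge0 A : 0 <= rmeas A.
Proof. exact: fine_ge0. Qed.

Lemma le_rmeas A B : measurable A -> measurable B -> A `<=` B -> rmeas A <= rmeas B.
Proof. by move=> mA mB AB; rewrite -lee_fin -!rmeasE // le_measure ?inE. Qed.

Lemma rmeasU A B : measurable A -> measurable B -> rmeas (A `|` B) <= rmeas A + rmeas B.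
Proof.
move=> mA mB; rewrite -lee_fin EFinD -!rmeasE //; last exact: measurableU.
exact: measureU2.
Qed.

Lemma rmeas_split A B : measurable A -> measurable B ->
  rmeas A = rmeas (A `&` B) + rmeas (A `\` B).
Proof.
move=> mA mB; have mI := measurableI _ _ mA mB; have mD := measurableD mA mB.
apply: EFin_inj; rewrite EFinD -!rmeasE // -measureU //; first by rewrite setUIDK.
by rewrite setDE setIACA setICr setI0.
Qed.

Lemma rmeas_vanish (F : (set X)^nat) e : (forall n, measurable (F n)) ->
  (forall n, F n.+1 `<=` F n) -> \bigcap_n F n = set0 -> 0 < e ->
  exists n, rmeas (F n) < e.
Proof.
move=> mF dF F0 e0.
have h : (mu \o F) x @[x --> \oo] --> mu (\bigcap_n F n).
  apply: nonincreasing_cvg_mu => //.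
  - by rewrite rmeasE // ltry.
  - by rewrite F0.
  - by apply/nonincreasing_seqP => n; apply/subsetPset.
rewrite F0 measure0 in h.
have /cvgrPdist_lt /(_ _ e0) [n _ hn] : (fine \o (mu \o F)) n @[n --> \oo] --> 0.
  exact: fine_cvg.
exists n; have := hn n (leqnn n).
by rewrite /= sub0r normrN ger0_norm // rmeas_ge0.
Qed.

Lemma rmeas_big_le (I : Type) (s : seq I) (P : pred I) (F : I -> set X) :
  (forall i, measurable (F i)) ->
  rmeas (\big[setU/set0]_(i <- s | P i) F i) <= \sum_(i <- s | P i) rmeas (F i).
Proof.
move=> mF; elim: s => [|i s IH]; first by rewrite !big_nil /rmeas measure0.
rewrite !big_cons; case: ifP => // _; apply: le_trans (rmeasU _ _) _ => //.
  exact: bigsetU_measurable.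
by rewrite lerD2l.
Qed.

End FiniteMeasure.

Section CellApproximation.
Variables (R : realType) (k : nat) (q : 'I_3 -> plane R) (K : set (plane R)).
Hypothesis hk : (2 <= k)%N.
Hypothesis hK : is_gasket k q K.
Implicit Types (w u v : seq (cell_index k)) (S : pred (seq (cell_index k))).

Definition cell w : set (plane R) := word_map q w @` K.

Definition cells N S : set (plane R) :=
  \big[setU/set0]_(w <- words (cell_index k) N | S w) cell w.

Lemma cellsP N S x : cells N S x <-> exists w, [/\ size w = N, S w & cell w x].
Proof.
rewrite /cells -bigcup_seq_cond; split=> [[w /= /andP [hw Sw] h]|[w [hw Sw h]]].
  by exists w; split => //; apply/eqP; rewrite -mem_words.
by exists w => //=; rewrite mem_words hw eqxx.
Qed.

Lemma cell_cat_sub u v : cell (u ++ v) `<=` cell u.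
Proof.
move=> _ [x Kx <-]; rewrite word_map_cat; exists (word_map q v x) => //.
exact: (gasket_word hK).
Qed.

Lemma cell_cover N x : K x -> exists2 w, size w = N & cell w x.
Proof.
have [_ _ E] := hK; elim: N x => [|N IH] x Kx; first by exists [::] => //; exists x.
move: Kx; rewrite {1}E => -[a _ [y Ky <-]].
have [w hw [z Kz zy]] := IH y Ky; exists (a :: w); first by rewrite /= hw.
by exists z => //=; rewrite zy.
Qed.

Lemma cells_refine N M S : cells N S = cells (N + M) (fun w => S (take N w)).
Proof.
apply/seteqP; split => x /cellsP [w [hw Sw hx]]; apply/cellsP.
  have [y Ky yx] := hx; have [v hv [z Kz zy]] := cell_cover M Ky.
  exists (w ++ v); split; first by rewrite size_cat hw hv.
    by rewrite -hw take_size_cat.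
  by exists z => //; rewrite word_map_cat zy.
exists (take N w); split => //; first by rewrite size_take hw; case: ltnP => //; lia.
by move: hx; rewrite -{1}(cat_take_drop N w); exact: cell_cat_sub.
Qed.

Lemma cellsU N S S' : cells N S `|` cells N S' = cells N (fun w => S w || S' w).
Proof.
apply/seteqP; split => x.
  by move=> [] /cellsP [w [hw Sw hx]]; apply/cellsP; exists w; rewrite Sw ?orbT.
move=> /cellsP [w [hw /orP [Sw|Sw] hx]]; [left|right]; apply/cellsP; by exists w.
Qed.

Lemma cells_cover N S : K `<=` cells N S `|` cells N (fun w => ~~ S w).
Proof.
move=> x /(cell_cover N) [w hw hx].
by case Sw: (S w); [left|right]; apply/cellsP; exists w; rewrite Sw.
Qed.

Lemma borel_closed (C : set (plane R)) : closed C -> measurable (C : set (borel_plane R)).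
Proof.
move=> cC; rewrite -[C]setCK; apply: measurableC.
by apply: (@sub_sigma_algebra _ setT open); exact: closed_openC.
Qed.

Lemma compact_cell w : compact (cell w).
Proof.
have [_ cK _] := hK; apply: continuous_compact => //.
by apply: continuous_subspaceT; exact: word_map_cont.
Qed.

Lemma closed_cell w : closed (cell w).
Proof. by have := compact_closed (@norm_hausdorff _ _) (@compact_cell w). Qed.

Lemma borel_cell w : measurable (cell w : set (borel_plane R)).
Proof. exact: (borel_closed (@closed_cell w)). Qed.

Lemma borel_cells N S : measurable (cells N S : set (borel_plane R)).
Proof. by apply: bigsetU_measurable => w _; exact: borel_cell. Qed.

Lemma borel_gasket : measurable (K : set (borel_plane R)).
Proof.
have [_ cK _] := hK; apply: borel_closed.
by have := compact_closed (@norm_hausdorff _ _) cK.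
Qed.

Lemma cell_diameter : exists D, forall w x y, cell w x -> cell w y ->
  `|x - y| <= D * (k%:R^-1) ^+ size w.
Proof.
have [_ /compact_bounded cK _] := hK.
have [M [_ hM]] := cK; exists (2 * (M + 1)) => w _ _ [x Kx <-] [y Ky <-].
rewrite word_mapB normrZ mulrC ger0_norm ?invr_ge0 ?exprn_ge0 // exprVn.
rewrite ler_wpM2r ?invr_ge0 ?exprn_ge0 // (le_trans (ler_normB _ _)) //.
have M1 : M < M + 1 by rewrite ltrDl.
have := hM _ M1 _ Kx; have := hM _ M1 _ Ky; rewrite /=; lra.
Qed.

Variable mu : {measure set (borel_plane R) -> \bar R}.
Hypothesis mu_carried : carried_by K mu.
Hypothesis mu_K_fin : (mu K < +oo)%E.

Let mu_setT : (mu setT <= mu K)%E.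
Proof.
rewrite -(setUv (K : set (borel_plane R))).
apply: le_trans (measureU2 mu borel_gasket (measurableC borel_gasket)) _.
by rewrite [X in (_ + X)%E](_ : _ = 0%E) ?adde0 //; exact: mu_carried.
Qed.

Lemma carried_finite : (mu setT < +oo)%E.
Proof. exact: le_lt_trans mu_setT mu_K_fin. Qed.

Local Notation m := (rmeas mu).

Hypothesis mass_cells : forall N, \sum_(w <- words (cell_index k) N) m (cell w) = m K.

Let mK0 : m (~` K) = 0.
Proof. by rewrite /rmeas (_ : mu _ = 0%E) //; exact: mu_carried. Qed.

Let le_mK (A B : set (borel_plane R)) : measurable A -> measurable B ->
  A `<=` B `|` ~` (K : set (borel_plane R)) -> m A <= m B.
Proof.
move=> mA mB AB; have mC := measurableC borel_gasket.
apply: le_trans (le_rmeas carried_finite mA (measurableU _ _ mB mC) AB) _.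
by apply: le_trans (rmeasU carried_finite mB mC) _; rewrite mK0 addr0.
Qed.

(** Subadditivity gives upper bounds for the union over [S] and for the union over its complement.
    The bounds add up to [m K], and the two unions cover [K], so both are equalities and overlaps
    are null. *)
Lemma rmeas_cells N S : m (cells N S) = \sum_(w <- words (cell_index k) N | S w) m (cell w).
Proof.
have hle S' : m (cells N S') <= \sum_(w <- words (cell_index k) N | S' w) m (cell w).
  by apply: rmeas_big_le => [|w]; [exact: carried_finite | exact: borel_cell].
apply: le_anti; rewrite hle /=.
have h1 : m K <= m (cells N S) + m (cells N (fun w => ~~ S w)).
  apply: le_trans (rmeasU carried_finite (borel_cells _ _) (borel_cells _ _)).
  apply: le_rmeas; [exact: carried_finite|exact: borel_gasket| |exact: cells_cover].
  by apply: measurableU; exact: borel_cells.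
have := hle (fun w => ~~ S w); rewrite -(mass_cells N) (bigID S) /= in h1; lra.
Qed.

Lemma rmeas_cells_overlap N S : m (cells N S `&` cells N (fun w => ~~ S w)) = 0.
Proof.
set A := cells N S; set B := cells N _.
have mA : measurable (A : set (borel_plane R)) by exact: borel_cells.
have mB : measurable (B : set (borel_plane R)) by exact: borel_cells.
have h1 : m K = m A + m B by rewrite !rmeas_cells -(mass_cells N) (bigID S).
have h2 := rmeas_split carried_finite mA mB.
have mD := measurableD mA mB.
have h3 : m K <= m (A `\` B) + m B.
  apply: le_trans (rmeasU carried_finite mD mB).
  apply: le_rmeas; [exact: carried_finite|exact: borel_gasket|exact: measurableU|].
  move=> x /(@cells_cover N S) [hA|hB]; last by right.
  by have [hB|hB] := pselect (B x); [right|left].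
by have := rmeas_ge0 mu (A `&` B); lra.
Qed.

Definition cell_approx (A : set (plane R)) : Prop :=
  measurable (A : set (borel_plane R)) /\ forall e, 0 < e ->
    exists N S, m (A `\` cells N S) < e /\ m (cells N S `\` A) < e.

Lemma cell_approxC A : cell_approx A -> cell_approx (~` A).
Proof.
move=> [mA hA]; split=> [|e e0]; first exact: measurableC.
have [N [S [h1 h2]]] := hA _ e0; exists N, (fun w => ~~ S w).
have mS := borel_cells N S; have mS' := borel_cells N (fun w => ~~ S w).
have mA' := measurableC mA.
split.
  apply: le_lt_trans h2; apply: le_mK; [exact: measurableD|exact: measurableD|].
  move=> x [Ax Sx]; have [Kx|Kx] := pselect (K x); last by right.
  by left; split => //; have [] := @cells_cover N S x Kx.
apply: le_lt_trans h1.
apply: (@le_trans _ _ (m ((A `\` cells N S) `|`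
    (cells N S `&` cells N (fun w => ~~ S w))))).
  apply: le_rmeas; [exact: carried_finite|exact: measurableD| |].
    by apply: measurableU; [exact: measurableD|exact: measurableI].
  move=> x [Sx /contrapT Ax]; have [h|h] := pselect (cells N S x); first by right.
  by left.
apply: le_trans (rmeasU carried_finite _ _) _; [exact: measurableD|exact: measurableI|].
by rewrite rmeas_cells_overlap addr0.
Qed.

Lemma cell_approx0 : cell_approx set0.
Proof.
split=> [|e e0]; first exact: measurable0.
exists 0%N, pred0; rewrite set0D setD0 (_ : cells 0 pred0 = set0).
  by rewrite /rmeas measure0.
by rewrite /cells big_pred0.
Qed.

Lemma cell_approxU A B : cell_approx A -> cell_approx B -> cell_approx (A `|` B).
Proof.
move=> [mA hA] [mB hB]; split=> [|e e0]; first exact: measurableU.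
have e2 : 0 < e / 2 by rewrite divr_gt0.
have [N [S [h1 h2]]] := hA _ e2; have [N' [S' [h3 h4]]] := hB _ e2.
rewrite (cells_refine N N') in h1 h2.
rewrite (cells_refine N' N) addnC in h3 h4.
set S1 := (fun w => S (take N w)) in h1 h2; set S2 := (fun w => S' (take N' w)) in h3 h4.
exists (N + N')%N, (fun w => S1 w || S2 w); rewrite -cellsU.
have mS1 := borel_cells (N + N') S1; have mS2 := borel_cells (N + N') S2.
split.
  apply: (@le_lt_trans _ _ (m (A `\` cells (N + N') S1) + m (B `\` cells (N + N') S2))).
    apply: le_trans (rmeasU carried_finite _ _); try exact: measurableD.
    apply: le_rmeas; [exact: carried_finite| | |].
    + by apply: measurableD; exact: measurableU.
    + by apply: measurableU; exact: measurableD.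
    by move=> x [[Ax|Bx] /not_orP [n1 n2]]; [left|right].
  by move: h1 h3; lra.
apply: (@le_lt_trans _ _ (m (cells (N + N') S1 `\` A) + m (cells (N + N') S2 `\` B))).
  apply: le_trans (rmeasU carried_finite _ _); try exact: measurableD.
  apply: le_rmeas; [exact: carried_finite| | |].
  + by apply: measurableD; exact: measurableU.
  + by apply: measurableU; exact: measurableD.
  by move=> x [[Ax|Bx] /not_orP [n1 n2]]; [left|right].
by move: h2 h4; lra.
Qed.

Lemma cell_approx_bigcup (F : (set (plane R))^nat) :
  (forall n, cell_approx (F n)) -> cell_approx (\bigcup_n F n).
Proof.
move=> hF; have mF n : measurable (F n : set (borel_plane R)) := (hF n).1.
have mU : measurable (\bigcup_n F n : set (borel_plane R)) by exact: bigcupT_measurable.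
split=> // e e0; have e2 : 0 < e / 2 by rewrite divr_gt0.
pose G n := \big[setU/set0]_(i < n) F i.
have hG n : cell_approx (G n).
  elim: n => [|n IH]; first by rewrite /G big_ord0; exact: cell_approx0.
  by rewrite /G big_ord_recr; exact: cell_approxU.
have mG n : measurable (G n : set (borel_plane R)) := (hG n).1.
have GU n : G n `<=` \bigcup_n F n.
  by rewrite /G -bigcup_mkord => x [i _ Fx]; exists i.
have [n hn] : exists n, m ((\bigcup_n F n) `\` G n) < e / 2.
  apply: (rmeas_vanish carried_finite) e2 => [n|n|].
  - exact: measurableD.
  - move=> x [Ux Gx]; split => // Gn; apply: Gx; rewrite /G big_ord_recr; by left.
  apply/seteqP; split => // x hx; have [[i _ Fx] _] := hx 0%N I.
  have [_] := hx i.+1 I; apply; rewrite /G big_ord_recr; by right.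
have [_ /(_ _ e2) [N [S [h1 h2]]]] := hG n.
have mS := borel_cells N S.
exists N, S; split.
  apply: (@le_lt_trans _ _ (m ((\bigcup_n F n) `\` G n) + m (G n `\` cells N S))).
    apply: le_trans (rmeasU carried_finite _ _); try exact: measurableD.
    apply: le_rmeas; [exact: carried_finite|exact: measurableD| |].
      by apply: measurableU; exact: measurableD.
    move=> x [Ux nS]; have [Gx|Gx] := pselect (G n x); [by right|by left].
  by move: hn h1; lra.
apply: le_lt_trans (_ : m (cells N S `\` G n) < _); last by move: h2; lra.
apply: le_rmeas; [exact: carried_finite|exact: measurableD|exact: measurableD|].
by move=> x [Sx Ux]; split => // /GU.
Qed.

(** Inside [K], a closed set is the decreasing intersection over N of the unions of the level-N
    cells that meet it, because diameters tend to 0. *)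
Lemma cell_approx_closed C : closed C -> cell_approx C.
Proof.
move=> cC; have mC := borel_closed cC; split=> // e e0.
pose S w := `[< (cell w `&` C) !=set0 >].
pose F N := cells N S `\` C.
have mF N : measurable (F N : set (borel_plane R)).
  by apply: measurableD => //; exact: borel_cells.
have [D hD] := cell_diameter.
have [N hN] : exists N, m (F N) < e.
  apply: (rmeas_vanish carried_finite) e0 => // [N|].
    move=> x [/cellsP [w [hw /asboolP [y [wy Cy]] wx]] Cx]; split => //.
    apply/cellsP; exists (take N w); split; first by rewrite size_take hw ltnSn.
      apply/asboolP; exists y; split => //.
      by move: wy; rewrite -{1}(cat_take_drop N w); exact: cell_cat_sub.
    by move: wx; rewrite -{1}(cat_take_drop N w); exact: cell_cat_sub.
  apply/seteqP; split => // x hx; have [_ nC] := hx 0%N I; apply: nC.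
  apply: (closed_approx cC) => d d0.
  have [N hN] := geometric_small D (natr_inv01 R hk) d0.
  have [/cellsP [w [hw /asboolP [y [wy Cy]] wx]] _] := hx N I.
  by exists y => //; apply: le_lt_trans (hD _ _ _ wx wy) _; rewrite hw.
exists N, S; split => //.
rewrite (_ : m _ = 0) //; apply/eqP; rewrite eq_le rmeas_ge0 andbT -mK0.
have mS := borel_cells N S.
apply: le_rmeas; [exact: carried_finite|exact: measurableD|exact: measurableC borel_gasket|].
move=> x [Cx nS] Kx; apply: nS; apply/cellsP.
by have [w hw wx] := cell_cover N Kx; exists w; split => //; apply/asboolP; exists x.
Qed.

Lemma cell_approx_borel A : measurable (A : set (borel_plane R)) -> cell_approx A.
Proof.
apply: (@smallest_sub _ (sigma_algebra setT) open cell_approx).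
  split; first exact: cell_approx0.
    by move=> B hB; rewrite setTD; exact: cell_approxC.
  exact: cell_approx_bigcup.
move=> U oU; rewrite -[U]setCK; apply: cell_approxC; apply: cell_approx_closed.
exact: open_closedC.
Qed.

End CellApproximation.

(** * Energy measures *)

Section Energy.
Variables (R : realType) (k : nat) (q : 'I_3 -> plane R) (K : set (plane R)) (r : R).
Hypothesis hk : (2 <= k)%N.
Hypothesis hq : equilateral q.
Hypothesis hK : is_gasket k q K.
Hypothesis r01 : 0 < r < 1.
Implicit Types (f h : plane R -> R) (w u v : seq (cell_index k)) (x y : 'I_3 -> R).
Implicit Types (S : pred (seq (cell_index k))).
Local Notation W := (words (cell_index k)).
Local Notation T x := (tri_form x x).

Let r_gt0 : 0 < r. Proof. by case/andP: r01. Qed.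
Let r_neq0 : r != 0. Proof. by rewrite gt_eqF. Qed.
Let rho_gt0 : 0 < r^-1. Proof. by rewrite invr_gt0. Qed.
Let rhoX_gt0 n : 0 < r^-1 ^+ n. Proof. by rewrite exprn_gt0. Qed.

Definition cell_energy f w M : R :=
  r^-1 ^+ (size w + M) * \sum_(v <- W M) T (cell_values q f (w ++ v)).

Lemma cell_energyE f w M :
  r ^- (size w + M) * edge_sum k q (size w + M) (word_map q w @` K) f f = cell_energy f w M.
Proof. by rewrite edge_sum_cellE // /cell_energy exprVn. Qed.

Lemma energyE f M : energy k q r M f f = cell_energy f [::] M.
Proof. by rewrite /energy edge_sumE // /cell_energy exprVn. Qed.

Lemma cell_nil : word_map q ([::] : seq (cell_index k)) @` K = K.
Proof. exact: image_id. Qed.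

Lemma cell_energy_ge0 f w M : 0 <= cell_energy f w M.
Proof.
by rewrite mulr_ge0 ?(ltW (rhoX_gt0 _)) // sumr_ge0 // => v _; exact: tri_form_ge0.
Qed.

Lemma sum_cell_energy f N M : \sum_(w <- W N) cell_energy f w M = cell_energy f [::] (N + M).
Proof.
rewrite /cell_energy sum_words_cat mulr_sumr big_seq [RHS]big_seq.
apply: eq_bigr => w; rewrite mem_words => /eqP ->.
by rewrite add0n; congr (_ * _); apply: eq_bigr.
Qed.

Section EnergyMeasure.
Variables (f : plane R -> R) (nu : {measure set (borel_plane R) -> \bar R}).
Hypothesis hnu : is_energy_measure k q K r f nu.

Lemma energy_measure_finite : (nu setT < +oo)%E.
Proof. by case: hnu => c fin _; exact: (carried_finite hK c fin). Qed.

Lemma cell_energy_cvg w : cell_energy f w n @[n --> \oo] --> rmeas nu (cell q K w).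
Proof.
have [c fin /(_ w) h] := hnu.
rewrite (rmeasE energy_measure_finite (borel_cell hK w)) in h.
have /fine_cvg h' := h.
rewrite -(cvg_shiftn (size w)) in h'.
suff -> : cell_energy f w = fun n => (fine \o (fun m => (r ^- m *
   edge_sum k q m (word_map q w @` K) f f)%:E)) (n + size w)%N by [].
by apply/funext => n /=; rewrite addnC cell_energyE.
Qed.

Lemma energy_measure_cells N : \sum_(w <- W N) rmeas nu (cell q K w) = rmeas nu K.
Proof.
have h1 : \sum_(w <- W N) cell_energy f w n @[n --> \oo] --> \sum_(w <- W N) rmeas nu (cell q K w).
  by apply: cvg_big => [|w _]; [exact: add_continuous | exact: cell_energy_cvg].
have h2 := @cell_energy_cvg [::].
rewrite /cell cell_nil -(cvg_shiftn N) in h2.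
rewrite (_ : (fun n => _) = (fun n => cell_energy f [::] (n + N)%N)) in h1; last first.
  by apply/funext => n; rewrite sum_cell_energy addnC.
exact: (cvg_unique _ h1 h2).
Qed.

End EnergyMeasure.

Variable H : ('I_3 -> R) -> plane R -> R.
Hypothesis H_vertex : forall x l, H x (q l) = x l.
Hypothesis H_lin : forall x y s t p,
  H (fun i => s * x i + t * y i) p = s * H x p + t * H y p.
Hypothesis H_form : forall x f, level1_form k q (H x) f = r * tri_form x (f \o q).
Hypothesis H_harm : forall x, grid_harmonic k (grid_values k q (H x)).

Local Notation A := (restr (k := k) q H).

Fixpoint restr_word w x : 'I_3 -> R := if w is a :: w' then restr_word w' (A a x) else x.

Lemma restr_word_cat u v x : restr_word (u ++ v) x = restr_word v (restr_word u x).
Proof. by elim: u x => //= a u IH x. Qed.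

Lemma cell_values_cat f u v i :
  cell_values q f (u ++ v) i = cell_values q (f \o word_map q u) v i.
Proof. by rewrite /cell_values /= word_map_cat. Qed.

Lemma cell_values_harmonic h w v : gasket_harmonic k q K h ->
  cell_values q h (w ++ v) = restr_word v (cell_values q h w).
Proof.
move=> hh; elim: v w => [|a v IH] w; first by rewrite cats0.
rewrite -cat1s catA IH /=; congr restr_word.
have -> : cell_values q h (w ++ [:: a]) = cell_values q (h \o word_map q w) [:: a].
  by apply/funext => i; rewrite cell_values_cat.
rewrite (restr_harmonic hk H_vertex H_harm) //.
exact: (@gasket_harmonic_grid _ _ _ K hk hq h w hh).
Qed.

Lemma restr_word_pairing M x f w : \sum_(v <- W M) r^-1 ^+ M *
    tri_form (restr_word v x) (cell_values q f (w ++ v)) = tri_form x (cell_values q f w).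
Proof.
elim: M x w => [|M IH] x w; first by rewrite big_seq1 expr0 mul1r cats0.
rewrite sum_wordsS.
rewrite -[RHS](restr_pairing r01 H_form x (f \o word_map q w)); apply: eq_bigr => a _.
have -> : cell_values q (f \o word_map q w) [:: a] = cell_values q f (w ++ [:: a]).
  by apply/funext => i; rewrite cell_values_cat.
rewrite -(IH _ (w ++ [:: a])) mulr_sumr; apply: eq_bigr => v _.
by rewrite exprS mulrA -catA.
Qed.

Lemma restr_word_split M x y :
  \sum_(v <- W M) r^-1 ^+ M * tri_form (restr_word v x) (restr_word v y) = tri_form x y.
Proof.
elim: M x y => [|M IH] x y; first by rewrite big_seq1 expr0 mul1r.
rewrite sum_wordsS (restr_split H_vertex r01 H_form); apply: eq_bigr => a _.
rewrite -(IH (A a x)) mulr_sumr; apply: eq_bigr => v _.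
by rewrite exprS mulrA.
Qed.

Lemma cell_energy_harmonic h w M : gasket_harmonic k q K h ->
  cell_energy h w M = r^-1 ^+ size w * T (cell_values q h w).
Proof.
move=> hh; rewrite /cell_energy exprD -mulrA; congr (_ * _).
rewrite -(restr_word_split M (cell_values q h w)) mulr_sumr.
by apply: eq_bigr => v _; rewrite cell_values_harmonic.
Qed.

(* Pythagoras: [f] minus its harmonic interpolation of level [n] is orthogonal
   to that interpolation. *)
Lemma interpolation_error f n M :
  \sum_(u <- W n) \sum_(v <- W M) r^-1 ^+ (n + M) *
    T (fun i => 1 * cell_values q f (u ++ v) i + (-1) * restr_word v (cell_values q f u) i) =
  cell_energy f [::] (n + M) - cell_energy f [::] n.
Proof.
rewrite -sum_cell_energy /cell_energy -[X in _ - X]/(r^-1 ^+ n * _) mulr_sumr -sumrB.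
rewrite big_seq [RHS]big_seq; apply: eq_bigr => u; rewrite mem_words => /eqP hu.
have -> : r^-1 ^+ n * T (cell_values q f ([::] ++ u)) = r^-1 ^+ n * T (cell_values q f u) by [].
have e1 := restr_word_split M (cell_values q f u) (cell_values q f u).
have e2 := restr_word_pairing M (cell_values q f u) f u.
rewrite hu mulr_sumr.
apply/eqP; rewrite eq_sym subr_eq; apply/eqP.
have -> : r^-1 ^+ n * T (cell_values q f u) = r^-1 ^+ n * (2 * T (cell_values q f u)
    - T (cell_values q f u)) by ring.
rewrite -{1}e2 -[X in _ - X]e1 mulr_sumr -sumrB mulr_sumr -big_split /=.
apply: eq_bigr => v _; rewrite exprD !tri_formE; ring.
Qed.

Lemma mass_restr N x S : mass A r^-1 (fun x => T x) N x S =
  \sum_(v <- W N | S v) r^-1 ^+ N * T (restr_word v x).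
Proof.
elim: N x S => [|N IH] x S /=; first by rewrite big_mkcond big_seq1 expr0 mul1r.
rewrite [RHS]big_mkcond sum_wordsS; apply: eq_bigr => a _.
rewrite IH mulr_sumr big_mkcond; apply: eq_bigr => v _.
by case: ifP => // _; rewrite exprS mulrA.
Qed.

Lemma restr_word_lower_bound c : 0 < c ->
  (forall a x, c * T x <= r^-1 * T (A a x)) ->
  forall w x, c ^+ size w * T x <= r^-1 ^+ size w * T (restr_word w x).
Proof.
move=> c0 hc; elim=> [|a w IH] x /=; first by rewrite !expr0.
rewrite !exprS -!mulrA mulrCA; apply: (@le_trans _ _ (c ^+ size w * (r^-1 * T (A a x)))).
  by rewrite ler_wpM2l ?exprn_ge0 // ltW.
by rewrite mulrCA ler_wpM2l // ltW.
Qed.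

(** * Absolute continuity with respect to the energy measure of a harmonic function *)

Section Domination.
Variables (h f : plane R -> R) (nu_h nu_f : {measure set (borel_plane R) -> \bar R}).
Hypothesis h_harmonic : gasket_harmonic k q K h.
Hypothesis h_energy : 0 < T (cell_values (k := k) q h [::]).
Hypothesis nu_hP : is_energy_measure k q K r h nu_h.
Hypothesis nu_fP : is_energy_measure k q K r f nu_f.

Let nu_h_cell w : rmeas nu_h (cell q K w) = r^-1 ^+ size w * T (cell_values q h w).
Proof.
have h1 := @cell_energy_cvg _ _ nu_hP w.
rewrite (_ : cell_energy h w = fun=> r^-1 ^+ size w * T (cell_values q h w)) in h1.
  exact: (cvg_unique _ h1 (cvg_cst _)).
by apply/funext => n; rewrite cell_energy_harmonic.
Qed.

Let rmeas_nu nu g N S : is_energy_measure k q K r g nu ->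
  rmeas nu (cells q K N S) = \sum_(w <- W N | S w) rmeas nu (cell q K w).
Proof.
move=> hnu; have [c fin _] := hnu.
exact: (rmeas_cells hK c fin (energy_measure_cells hnu)).
Qed.

(** From some level n on, [f] differs from its interpolation of level n by an energy of at most
    [eta / 4]. In each cell of that level the interpolation is compared with the restriction of [h],
    with the same [eps1] everywhere. *)
Lemma cells_abs_continuous eta : 0 < eta -> exists2 eps, 0 < eps &
  forall N S, rmeas nu_h (cells q K N S) < eps -> rmeas nu_f (cells q K N S) <= eta.
Proof.
move=> eta0.
have e8 : 0 < eta / 8 by rewrite divr_gt0.
have hE := @cell_energy_cvg _ _ nu_fP [::].
have /cvgrPdist_lt /(_ _ e8) [n _ hn] := hE.
pose E n := cell_energy f [::] n.
have hn' P : E (n + P)%N - E n <= eta / 4.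
  have := hn n (leqnn n); have := hn (n + P)%N (leq_addr P n).
  by rewrite /= !ltr_norml -/(E n) -/(E (n + P)%N) => /andP [? ?] /andP [? ?]; lra.
have En0 : 0 <= E n by exact: cell_energy_ge0.
(* Chosen so that [beta * E n <= eta / 4], also when [E n] is 0. *)
pose beta := eta / (4 * (E n + 1)).
have b0 : 0 < beta by rewrite divr_gt0 // mulr_gt0 // ltr_wpDl.
have [eps1 eps10 hac] := restr_abs_continuous hk hq H_vertex H_lin H_harm r01 H_form b0.
have [c c0 hc] := restr_lower_bound hk H_vertex H_lin H_harm r01.
have hcw := restr_word_lower_bound c0 hc.
exists (eps1 * (c ^+ n * T (cell_values (k := k) q h [::]))).
  (* The second factor bounds from below the energy of [h] in each cell of level n. A total below
     this product thus leaves at most the proportion [eps1] in each of them. *)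
  by apply: mulr_gt0 => //; apply: mulr_gt0 => //; exact: exprn_gt0.
move=> N S0; rewrite (cells_refine hk hK N n) addnC; set S := (fun w => S0 (take N w)).
rewrite (@rmeas_nu _ _ _ _ nu_hP) (@rmeas_nu _ _ _ _ nu_fP) => hS.
pose xh u := cell_values q h u; pose xf u := cell_values q f u.
have Tn : r^-1 ^+ n * \sum_(u <- W n) T (xf u) = E n by [].
have hu u : u \in W n -> mass A r^-1 (fun x => T x) N (xf u) (fun v => S (u ++ v)) <=
    beta * T (xf u).
  rewrite mem_words => /eqP su.
  have hxu : xh u = restr_word u (xh [::]) by rewrite /xh -[in LHS](cat0s u) cell_values_harmonic.
  have lb : c ^+ n * T (xh [::]) <= r^-1 ^+ n * T (xh u) by rewrite hxu -su hcw.
  have xu0 : 0 < T (xh u).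
    rewrite -(pmulr_rgt0 _ (rhoX_gt0 n)); apply: lt_le_trans lb.
    by rewrite mulr_gt0 ?exprn_gt0.
  apply: (hac N (xh u)) => //.
  rewrite -(ler_pM2l (rhoX_gt0 n)); apply: ltW.
  apply: (@lt_le_trans _ _ (eps1 * (c ^+ n * T (xh [::])))); last first.
    by rewrite [leRHS]mulrCA ler_pM2l.
  apply: le_lt_trans hS.
  rewrite big_mkcond sum_words_cat (bigD1_seq u) /=; [|by rewrite mem_words su|exact: words_uniq].
  rewrite mass_restr mulr_sumr big_mkcond.
  rewrite -[leLHS]addr0; apply: lerD; last first.
    apply: sumr_ge0 => u' _; apply: sumr_ge0 => v _; case: ifP => // _; exact: rmeas_ge0.
  rewrite le_eqVlt; apply/orP; left; apply/eqP.
  rewrite big_seq [RHS]big_seq; apply: eq_bigr => v; rewrite mem_words => /eqP sv.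
  case: ifP => // _; rewrite nu_h_cell size_cat su sv exprD -mulrA; congr (_ * (_ * _)).
  by rewrite cell_values_harmonic.
pose G M := \sum_(w <- W (n + N) | S w) cell_energy f w M.
have hG : G M @[M --> \oo] --> \sum_(w <- W (n + N) | S w) rmeas nu_f (cell q K w).
  by apply: cvg_big => [|w _]; [exact: add_continuous | exact: cell_energy_cvg].
apply: (@closed_cvg _ _ _ _ G (fun z => z <= eta) (@closed_le R eta) _ _ hG).
apply: nearW => M.
rewrite /G big_mkcond sum_words_cat.
pose D u v := \sum_(v' <- W M) r^-1 ^+ (n + (N + M)) *
  T (fun i => 1 * cell_values q f (u ++ (v ++ v')) i + (-1) * restr_word (v ++ v') (xf u) i).
(* The energy of [f] is at most twice that of the interpolation plus twice that of the error; each
   of the two is at most [eta / 4] in total. *)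
apply: (@le_trans _ _ (\sum_(u <- W n) \sum_(v <- W N)
   (2 * (if S (u ++ v) then r^-1 ^+ (n + N) * T (restr_word v (xf u)) else 0) + 2 * D u v))).
  rewrite !big_seq; apply: ler_sum => u; rewrite mem_words => /eqP su.
  rewrite !big_seq; apply: ler_sum => v; rewrite mem_words => /eqP sv.
  have D0 : 0 <= D u v.
    by apply: sumr_ge0 => v' _; rewrite mulr_ge0 ?tri_form_ge0 // ltW.
  case: ifP => _; last by rewrite mulr0 add0r mulr_ge0.
  rewrite /cell_energy size_cat su sv -(restr_word_split M (restr_word v (xf u))).
  rewrite !mulr_sumr -big_split; apply: ler_sum => v' _ /=.
  rewrite -restr_word_cat -catA addnA.
  rewrite [in X in _ <= 2 * X + _]mulrA -exprD !(mulrCA 2 (r^-1 ^+ _)) -mulrDr ler_pM2l //.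
  exact: tri_form_parallelogram.
under eq_bigr do rewrite big_split -!mulr_sumr.
rewrite big_split /= -!mulr_sumr.
have -> : \sum_(u <- W n) \sum_(v <- W N) D u v = E (n + (N + M))%N - E n.
  by rewrite -interpolation_error; apply: eq_bigr => u _; rewrite sum_words_cat.
have := hn' (N + M)%N.
suff : \sum_(u <- W n) \sum_(v <- W N) (if S (u ++ v) then
    r^-1 ^+ (n + N) * T (restr_word v (xf u)) else 0) <= eta / 4 by lra.
apply: (@le_trans _ _ (\sum_(u <- W n) r^-1 ^+ n * (beta * T (xf u)))).
  rewrite big_seq [leRHS]big_seq; apply: ler_sum => u /hu hmu.
  have hmu' := hmu; rewrite -(ler_pM2l (rhoX_gt0 n)) in hmu'; apply: le_trans hmu'.
  rewrite mass_restr mulr_sumr [leRHS]big_mkcond.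
  by apply: ler_sum => v _; case: ifP => // _; rewrite exprD -mulrA.
rewrite -mulr_sumr -mulr_sumr mulrCA Tn /beta.
have E1 : 0 < E n + 1 by rewrite ltr_wpDl.
rewrite mulrAC ler_pdivrMr ?mulr_gt0 //.
have -> : eta / 4 * (4 * (E n + 1)) = eta * (E n + 1) by field.
by rewrite ler_pM2l // lerDl.
Qed.

Lemma energy_measure_dominated : nu_f `<< nu_h.
Proof.
apply/null_content_dominatesP => B mB B0.
have [ch finh _] := nu_hP; have [cf finf _] := nu_fP.
have fh := carried_finite hK ch finh; have ff := carried_finite hK cf finf.
(* One union of cells must approximate [B] for both measures, hence the approximation with respect
   to their sum. *)
pose mu : {measure set (borel_plane R) -> \bar R} := measure_add nu_h nu_f.
have muD C : mu C = (nu_h C + nu_f C)%E by exact: measure_addE.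
have muE C : measurable (C : set (borel_plane R)) -> rmeas mu C = rmeas nu_h C + rmeas nu_f C.
  move=> mC; apply: EFin_inj.
  have mufin : (mu setT < +oo)%E by rewrite muD lte_add_pinfty.
  rewrite -rmeasE // EFinD -!rmeasE //; exact: muD.
have muC : carried_by K mu.
  by rewrite /carried_by muD; rewrite /carried_by in ch cf; rewrite ch cf adde0.
have muK : (mu K < +oo)%E by rewrite muD lte_add_pinfty.
have mucells N : \sum_(w <- W N) rmeas mu (cell q K w) = rmeas mu K.
  rewrite muE; last exact: (borel_gasket hK).
  rewrite -(energy_measure_cells nu_hP N) -(energy_measure_cells nu_fP N) -big_split.
  by apply: eq_bigr => w _; rewrite muE //; exact: (borel_cell hK).
have [_ happ] := cell_approx_borel hk hK muC muK mucells mB.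
rewrite (rmeasE ff) //; congr _%:E.
apply/eqP; rewrite eq_le rmeas_ge0 andbT; apply/ler_addgt0Pl => eta eta0.
have e2 : 0 < eta / 2 by rewrite divr_gt0.
have [eps eps0 hac] := cells_abs_continuous e2.
have m0 : 0 < Num.min eps (eta / 2) by rewrite lt_min eps0.
have [N [S]] := happ _ m0; have mS := borel_cells hK N S.
rewrite !muE; try exact: measurableD.
rewrite !lt_min => -[/andP [a1 a2] /andP [b1 b2]].
have B0' : rmeas nu_h B = 0 by rewrite /rmeas B0.
have bound (nu : {measure set (borel_plane R) -> \bar R}) (C C' : set (borel_plane R)) : (nu setT < +oo)%E -> measurable (C : set (borel_plane R)) ->
    measurable (C' : set (borel_plane R)) -> rmeas nu C <= rmeas nu C' + rmeas nu (C `\` C').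
  move=> fin mC mC'; have mD := measurableD mC mC'.
  apply: le_trans (rmeasU fin mC' mD); apply: le_rmeas => //; first exact: measurableU.
  by move=> x Cx; have [h'|h'] := pselect (C' x); [left|right].
have hh := bound _ _ _ fh mS mB; have hf := bound _ _ _ ff mB mS.
have pf := rmeas_ge0 nu_f (cells q K N S `\` B); have ph := rmeas_ge0 nu_h (B `\` cells q K N S).
have := hac N S ltac:(rewrite B0' in hh; lra).
by rewrite addr0; lra.
Qed.

End Domination.

(** Restriction preserves constants, so [h] takes the value [s] at the vertices of all levels, which
    are dense in [K]. *)
Lemma harmonic_cst h s : gasket_harmonic k q K h -> (forall i, h (q i) = s) ->
  forall p, K p -> h p = s.
Proof.
move=> hh hs x Kx; have hw w i : h (word_map q w (q i)) = s.
  rewrite -[LHS]/(cell_values q h w i) -[w]cat0s cell_values_harmonic //.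
  have -> : cell_values (k := k) q h [::] = fun=> s by apply/funext => j; exact: hs.
  elim: w => //= a w IH; rewrite (restr_cst hk H_vertex H_harm); exact: IH.
have [hc _] := hh; have [D hD] := cell_diameter hK.
apply/eqP; rewrite -subr_eq0 -normr_le0; apply/ler_addgt0Pl => e e0; rewrite addr0.
have /subspace_continuousP /(_ x Kx) /cvgrPdist_lt /(_ _ e0) := hc.
rewrite near_withinE => /nbhs_ballP [d d0 hd].
have [N hN] := geometric_small D (natr_inv01 R hk) d0.
have [w sw wx] := cell_cover hK N Kx.
have wq : cell q K w (word_map q w (q o0)) by exists (q o0) => //; exact: (gasket_vertex hk hK).
rewrite -(hw w o0); apply: ltW; apply: (hd (word_map q w (q o0))).
  by rewrite -ball_normE /=; apply: le_lt_trans (hD _ _ _ wx wq) _; rewrite sw.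
by apply: (gasket_word hK); exact: (gasket_vertex hk hK).
Qed.

Lemma nonconstant_energy h : gasket_harmonic k q K h -> nonconstant_on K h ->
  0 < T (cell_values (k := k) q h [::]).
Proof.
move=> hh [x [y [Kx Ky]]] hxy; rewrite lt_def tri_form_ge0 andbT; apply/eqP => /tri_form_eq0 e.
apply: hxy; rewrite !(harmonic_cst hh (s := h (q o0))) // => i; exact: (e i o0).
Qed.

Lemma energy_measure_finite_energy f nu : {within K, continuous f} ->
  is_energy_measure k q K r f nu -> finite_energy k q K r f.
Proof.
move=> cf hnu; split => //; apply/cvg_ex; exists (rmeas nu (cell q K ([::] : seq (cell_index k)))).
rewrite (_ : (fun m => _) = cell_energy f [::]); first exact: (cell_energy_cvg hnu).
by apply/funext => m; rewrite energyE.
Qed.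

End Energy.

Theorem theorem1p2 (R : realType) (k : nat) (q : 'I_3 -> plane R)
    (K : set (plane R)) (r : R)
    (hk : (2 <= k)%N) (hq : equilateral q) (hK : is_gasket k q K)
    (hr : is_renormalization_constant k q r) :
  (forall (h : plane R -> R)
      (nu : {measure set (borel_plane R) -> \bar R}),
      gasket_harmonic k q K h -> nonconstant_on K h ->
      is_energy_measure k q K r h nu ->
      minimal_energy_dominant k q K r nu) /\
  (forall (h1 h2 : plane R -> R)
      (nu1 nu2 : {measure set (borel_plane R) -> \bar R}),
      gasket_harmonic k q K h1 -> nonconstant_on K h1 ->
      gasket_harmonic k q K h2 -> nonconstant_on K h2 ->
      is_energy_measure k q K r h1 nu1 ->
      is_energy_measure k q K r h2 nu2 ->
      nu1 `<< nu2 /\ nu2 `<< nu1).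
Proof.
have [r01 _] := hr; have [H [H1 H2 H3 H4]] := harmonic_extension hk hq hr.
have dom (h f : plane R -> R) (nu_h nu_f : {measure set (borel_plane R) -> \bar R}) :
    gasket_harmonic k q K h -> nonconstant_on K h -> is_energy_measure k q K r h nu_h ->
    is_energy_measure k q K r f nu_f -> nu_f `<< nu_h.
  move=> hh hn Eh Ef.
  exact: (energy_measure_dominated hk hq hK r01 H1 H2 H3 H4 hh
    (nonconstant_energy hk hq hK H1 H4 hh hn) Eh Ef).
split=> [h nu hh hn Eh|h1 h2 nu1 nu2 hh1 hn1 hh2 hn2 E1 E2]; last first.
  by split; [exact: dom hh2 hn2 E2 E1 | exact: dom hh1 hn1 E1 E2].
have [cnu fin _] := Eh.
split.
  split=> //; last by move=> f nu_f _ Ef; exact: dom hh hn Eh Ef.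
  exists (fun=> setT); first by rewrite bigcup_const.
  by move=> _; split; [exact: measurableT | exact: (carried_finite hK cnu fin)].
move=> nu' [_ _ hnu']; apply: (hnu' h nu _ Eh).
by apply: (energy_measure_finite_energy hk hq hK (proj1 hh) Eh).
Qed.
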